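(* Let $H:\mathbb{R}^n\to\mathbb{R}$ be a Tonelli Hamiltonian depending only on the momentum $p$, let $f\in C^2(\mathbb{T}^n,\mathbb{R})$, and let $H_\varepsilon(x,p)=H(p)+\varepsilon f(x)$ for $\varepsilon\ge0$. Assume that $H_\varepsilon$ is Tonelli for $\varepsilon$ sufficiently small and $H_\varepsilon\to H$ in the $C^2$ topology as $\varepsilon\to0$. Assume further that the Hamilton--Jacobi equation $H(du_0(x))=\alpha(0)$, $x\in\mathbb{T}^n$, admits a classical solution $u_0\in C^{1,1}(\mathbb{T}^n,\mathbb{R})$ such that $\widetilde{\mathcal{T}}_\omega=\{(x,du_0(x)):x\in\mathbb{T}^n\}$ is a KAM torus for $H$ with frequency $\omega\in\mathcal{D}_{\sigma,\tau}$. Then there exists a modulus of continuity $\Theta:\mathbb{R}^+\to\mathbb{R}^+$ with $\lim_{r\to0^+}\Theta(r)=0$ such that, for all sufficiently small $\varepsilon\ge0$, $$W_1\bigl(\widetilde{\mathfrak{M}}(\varepsilon),\widetilde{\mathfrak{M}}(0)\bigr)\le\Theta(\varepsilon),$$ where $\widetilde{\mathfrak{M}}(\varepsilon)$ denotes an arbitrary Mather measure associated with $H_\varepsilon$ and $\widetilde{\mathfrak{M}}(0)$ is the unique Mather measure associated with $H$.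
   Context: $\mathbb{T}^n=\mathbb{R}^n/\mathbb{Z}^n$ is the flat torus; $T\mathbb{T}^n$ and $T^*\mathbb{T}^n$ are identified with $\mathbb{T}^n\times\mathbb{R}^n$ with Euclidean product distance; $\pi$ is the canonical projection to $\mathbb{T}^n$. A Hamiltonian $H(x,p)$ is Tonelli if it is $C^2$, strictly convex (as usual, with positive definite $\partial_{pp}H$) and superlinear in $p$; its Lagrangian is $L(x,v)=\sup_p\{\langle p,v\rangle-H(x,p)\}$. $\alpha(\varepsilon)$ denotes the ergodic constant (Mañé critical value) of $H_\varepsilon$, i.e. the unique constant for which $H_\varepsilon(x,du(x))=\alpha(\varepsilon)$ has a viscosity solution on $\mathbb{T}^n$. For $\sigma>0$, $\tau\ge n-1$, $\mathcal{D}_{\sigma,\tau}$ is the set of $\omega\in\mathbb{R}^n$ with $|\langle\omega,k\rangle|\ge\sigma|k|^{-\tau}$ for all $k\in\mathbb{Z}^n\setminus\{0\}$. The torus $\widetilde{\mathcal{T}}_\omega=\{(x,du_0(x))\}$ is a KAM torus for $H$ with frequency $\omega$ if it is invariant under the Hamiltonian flow $\varphi_H^t$ and there is a diffeomorphism $\psi:\mathbb{T}^n\to\mathbb{T}^n$ with $\psi(\pi\circ\varphi_H^t(x,du_0(x)))=\psi(x)+\omega t\pmod{\mathbb{Z}^n}$ for all $x\in\mathbb{T}^n$, $t\in\mathbb{R}$. A Borel probability measure $\mu$ on $T\mathbb{T}^n$ is closed if $\int|v|\,d\mu<\infty$ and $\int d\phi(x)\cdot v\,d\mu=0$ for all $\phi\in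 C^1(\mathbb{T}^n,\mathbb{R})$. A Mather measure associated with a Hamiltonian is a closed probability measure minimizing the integral of the corresponding Lagrangian among all closed probability measures. Under the hypotheses, the Mather measure of $H$ is unique. $W_1(\mu,\nu)=\inf_{\Pi}\int d(x,y)\,d\Pi(x,y)$ is the 1-Wasserstein distance (infimum over couplings) on $T\mathbb{T}^n$. *)

(* Defs.v *)
From HB Require Import structures.
From mathcomp Require Import all_boot all_order all_algebra.
From mathcomp Require Import all_classical all_reals all_analysis.

Set Implicit Arguments.
Unset Strict Implicit.
Unset Printing Implicit Defensive.

Import Order.TTheory GRing.Theory Num.Theory.
Import numFieldNormedType.Exports.

Local Open Scope classical_set_scope.
Local Open Scope ring_scope.

(* The library norm on 'rV[R]_n is the sup norm; the Euclidean one is needed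
   for the distances, the superlinearity and the first moment. *)
Definition dot (R : realType) (n : nat) (u v : 'rV[R]_n) : R :=
  \sum_(i < n) u 0 i * v 0 i.

Definition enorm (R : realType) (n : nat) (u : 'rV[R]_n) : R :=
  Num.sqrt (dot u u).

Definition grad (R : realType) (n : nat) (g : 'rV[R]_n -> R) (x : 'rV[R]_n) :
  'rV[R]_n := \row_i 'D_(delta_mx 0 i) g x.

(* V is always finite-dimensional below, so the continuity of every directional
   derivative amounts to that of the differential. *)
Definition C1 (R : realType) (V : normedModType R) (g : V -> R) : Prop :=
  (forall x, differentiable g x) /\ (forall v, continuous ('D_v g)).

Definition C2 (R : realType) (V : normedModType R) (g : V -> R) : Prop :=
  C1 g /\ (forall v, C1 ('D_v g)).

(* Convergence, as e -> 0+, of G e to g together with the derivatives of order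
   1 and 2, uniformly on compact sets. *)
Definition cvg_C2 (R : realType) (V : normedModType R) (G : R -> V -> R)
    (g : V -> R) : Prop :=
  [/\ {family compact, G @ 0^'+ --> g},
      forall v, {family compact, (fun e => 'D_v (G e)) @ 0^'+ --> 'D_v g}
    & forall v w, {family compact,
        (fun e => 'D_w ('D_v (G e))) @ 0^'+ --> 'D_w ('D_v g)}].

Section Torus.
Variables (R : realType) (n : nat).

Definition torus_eq (x y : 'rV[R]_n) : bool :=
  [forall i, (x 0 i - y 0 i) \is a Num.int].

Lemma torus_eq_refl : reflexive torus_eq.
Proof. by move=> x; apply/forallP => i; rewrite subrr rpred0. Qed.

Lemma torus_eq_sym : symmetric torus_eq.
Proof.
by move=> x y; apply/forallP/forallP => h i; rewrite -opprB rpredN.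
Qed.

Lemma torus_eq_trans : transitive torus_eq.
Proof.
move=> y x z /forallP xy /forallP yz; apply/forallP => i.
by rewrite -(subrKA (y 0 i)) rpredD.
Qed.

Canonical torus_equiv :=
  EquivRel torus_eq torus_eq_refl torus_eq_sym torus_eq_trans.

Definition torus : Type := quotient_topology {eq_quot torus_equiv}%qT.

HB.instance Definition _ := Topological.on torus.
HB.instance Definition _ := Pointed.on torus.
HB.instance Definition _ := Quotient.on torus.

End Torus.

Definition tproj (R : realType) (n : nat) (x : 'rV[R]_n) : torus R n :=
  (\pi_(torus R n) x)%qT.

Definition translate (R : realType) (n : nat) (x : torus R n) (v : 'rV[R]_n) :
  torus R n := tproj (repr x + v).

Definition C1_torus (R : realType) (n : nat) (g : torus R n -> R) : Prop :=
  C1 (g \o @tproj R n).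

Definition C2_torus (R : realType) (n : nat) (g : torus R n -> R) : Prop :=
  C2 (g \o @tproj R n).

(* The value does not depend on the representative of x. *)
Definition dtorus (R : realType) (n : nat) (g : torus R n -> R)
  (x : torus R n) : 'rV[R]_n := grad (g \o @tproj R n) (repr x).

Definition C11_torus (R : realType) (n : nat) (g : torus R n -> R) : Prop :=
  C1_torus g /\
  exists K : R, forall x y : 'rV[R]_n,
    enorm (grad (g \o @tproj R n) x - grad (g \o @tproj R n) y)
    <= K * enorm (x - y).

(* A C^1 map of the torus is one with a C^1 lift to R^n: continuous maps of the
   torus always lift, R^n being simply connected. *)
Definition C1_torus_map (R : realType) (n : nat)
    (psi : torus R n -> torus R n) : Prop :=
  exists Psi : 'rV[R]_n -> 'rV[R]_n,
    (forall x, tproj (Psi x) = psi (tproj x)) /\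
    (forall i, C1 (fun x => Psi x 0 i)).

Definition torus_diffeomorphism (R : realType) (n : nat)
    (psi : torus R n -> torus R n) : Prop :=
  C1_torus_map psi /\
  exists psi' : torus R n -> torus R n,
    [/\ cancel psi psi', cancel psi' psi & C1_torus_map psi'].

(* T T^n and T^* T^n, both identified with T^n x R^n. *)
Definition phase (R : realType) (n : nat) : Type := (torus R n * 'rV[R]_n)%type.

Definition hamiltonian (R : realType) (n : nat) : Type :=
  torus R n -> 'rV[R]_n -> R.

Definition lift_ham (R : realType) (n : nat) (H : hamiltonian R n)
  (z : 'rV[R]_n * 'rV[R]_n) : R := H (tproj z.1) z.2.

Definition superlinear (R : realType) (n : nat) (H : hamiltonian R n) : Prop :=
  forall K : R, exists r : R, forall x p, r <= enorm p -> K * enorm p <= H x p.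

Definition Tonelli (R : realType) (n : nat) (H : hamiltonian R n) : Prop :=
  [/\ C2 (lift_ham H),
      forall x p v, v != 0 -> 0 < 'D_v ('D_v (H x)) p
    & superlinear H].

Definition lagrangian (R : realType) (n : nat) (H : hamiltonian R n)
    (x : torus R n) (v : 'rV[R]_n) : \bar R :=
  ereal_sup [set (dot p v - H x p)%:E | p in [set: 'rV[R]_n]].

Definition viscosity_subsolution (R : realType) (n : nat)
    (H : hamiltonian R n) (c : R) (u : torus R n -> R) : Prop :=
  forall (phi : torus R n -> R) (x : torus R n), C1_torus phi ->
    (\forall y \near x, u y - phi y <= u x - phi x) -> H x (dtorus phi x) <= c.

Definition viscosity_supersolution (R : realType) (n : nat)
    (H : hamiltonian R n) (c : R) (u : torus R n -> R) : Prop :=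
  forall (phi : torus R n -> R) (x : torus R n), C1_torus phi ->
    (\forall y \near x, u x - phi x <= u y - phi y) -> c <= H x (dtorus phi x).

Definition viscosity_solution (R : realType) (n : nat)
    (H : hamiltonian R n) (c : R) (u : torus R n -> R) : Prop :=
  [/\ continuous u, viscosity_subsolution H c u
    & viscosity_supersolution H c u].

(* "the unique c such that ..."; for a Tonelli H it exists *)
Definition ergodic_constant (R : realType) (n : nat) (H : hamiltonian R n) : R :=
  get [set c | (exists u, viscosity_solution H c u) /\
    forall c', (exists u, viscosity_solution H c' u) -> c' = c].

(* Since T^n is covered by R^n, the velocity of a curve in T^n is that of a
   lift X of it. *)
Definition hamiltonian_trajectory (R : realType) (n : nat)
    (H : hamiltonian R n) (g : R -> phase R n) : Prop :=
  exists X : R -> 'rV[R]_n, forall t : R,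
    [/\ tproj (X t) = (g t).1,
        is_derive t 1 X (grad (H (g t).1) (g t).2)
      & is_derive t 1 (fun s => (g s).2)
          (- dtorus (fun y => H y (g t).2) (g t).1)].

(* Solutions of Hamilton's equations are unique for H of class C^2, hence so is
   the flow. *)
Definition hamiltonian_flow (R : realType) (n : nat) (H : hamiltonian R n)
    (phi : R -> phase R n -> phase R n) : Prop :=
  forall z, phi 0 z = z /\ hamiltonian_trajectory H (phi ^~ z).

Definition diophantine (R : realType) (n : nat) (sigma tau : R) :
    set 'rV[R]_n :=
  [set omega | forall k : 'rV[int]_n, k != 0 ->
    let kR : 'rV[R]_n := map_mx intr k in
    sigma * enorm kR `^ (- tau) <= `|dot omega kR|].

Definition graph_du (R : realType) (n : nat) (u : torus R n -> R) :
  set (phase R n) := [set (x, dtorus u x) | x in [set: torus R n]].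

Definition KAM_torus (R : realType) (n : nat) (H : hamiltonian R n)
    (u : torus R n -> R) (omega : 'rV[R]_n) : Prop :=
  exists phi : R -> phase R n -> phase R n,
    [/\ hamiltonian_flow H phi,
        forall t, phi t @` graph_du u `<=` graph_du u
      & exists psi : torus R n -> torus R n,
          torus_diffeomorphism psi /\
          forall x t,
            psi (phi t (x, dtorus u x)).1 = translate (psi x) (t *: omega)].

Definition borel_phase (R : realType) (n : nat) : measurableType _ :=
  g_sigma_algebraType (@open (torus R n * 'rV[R]_n)%type).

Definition closed_measure (R : realType) (n : nat)
    (mu : probability (borel_phase R n) R) : Prop :=
  (\int[mu]_z (enorm z.2)%:E < +oo)%E /\
  forall phi : torus R n -> R, C1_torus phi ->
    (\int[mu]_z (dot (dtorus phi z.1) z.2)%:E = 0)%E.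

Definition Mather_measure (R : realType) (n : nat) (H : hamiltonian R n)
    (mu : probability (borel_phase R n) R) : Prop :=
  closed_measure mu /\
  forall nu : probability (borel_phase R n) R, closed_measure nu ->
    (\int[mu]_z lagrangian H z.1 z.2 <= \int[nu]_z lagrangian H z.1 z.2)%E.

Definition dist_torus (R : realType) (n : nat) (x y : torus R n) : R :=
  inf [set enorm (ab.1 - ab.2) |
       ab in [set ab : 'rV[R]_n * 'rV[R]_n | tproj ab.1 = x /\ tproj ab.2 = y]].

Definition dist_phase (R : realType) (n : nat) (z w : phase R n) : R :=
  Num.sqrt (dist_torus z.1 w.1 ^+ 2 + enorm (z.2 - w.2) ^+ 2).

(* The product sigma-algebra below is the Borel one, T^n x R^n being second
   countable. *)
Definition coupling (R : realType) (n : nat)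
    (mu nu : probability (borel_phase R n) R) :
    set (probability (borel_phase R n * borel_phase R n)%type R) :=
  [set P | forall A, measurable A ->
    P (A `*` setT) = mu A /\ P (setT `*` A) = nu A].

Definition W1 (R : realType) (n : nat)
    (mu nu : probability (borel_phase R n) R) : \bar R :=
  ereal_inf [set (\int[P]_zw (dist_phase zw.1 zw.2)%:E)%E |
             P in coupling mu nu].

Definition modulus_of_continuity (R : realType) (Theta : R -> R) : Prop :=
  [/\ Theta 0 = 0,
      forall r s, 0 <= r -> r <= s -> Theta r <= Theta s
    & Theta r @[r --> 0^'+] --> 0].

(* Main.v *)
Require Import Defs.
From HB Require Import structures.
From mathcomp Require Import all_boot all_order all_algebra.
From mathcomp Require Import all_classical all_reals all_analysis.
From mathcomp Require Import measurable_realfun ring lra.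
Import Order.TTheory GRing.Theory Num.Theory.
Import numFieldNormedType.Exports.

(** Write V for the gradient of H at 0 and mu0 for the product of the Haar
    measure of the torus with the Dirac mass at the velocity V. Everything rests
    on the deviation of a closed measure nu, the integral of |v - V| against nu.

    Mather measures of small perturbations have small deviation. By convexity
    L(v) + H(0) is nonnegative and vanishes at V, and the differentiability of H
    at 0 gives, for every eta > 0, some s > 0 with
    s |v - V| <= L(v) + H(0) + eta s ([velocity_penalty]). Using mu0 as a
    competitor in the minimisation for H + e f bounds s times the deviation by
    eta s + 2 e sup |f| ([Mather_estimate], [Mather_deviation]). For e = 0 the
    deviation vanishes.

    The drift V is nonresonant. At a maximum of u0 the momentum du0 is 0, so the
    KAM torus contains an orbit projecting onto a line x + t V, which the
    conjugacy psi sends to y + t omega. If <k, V> = 0 with k != 0, the angle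
    <k, .> read through a lift of the inverse of psi is constant along the
    second line; its vector of periods l is then orthogonal to omega, so l = 0
    and the angle is bounded, although composed with a lift of psi it is
    <k, x> up to a constant ([lift_nonresonant], [KAM_drift_nonresonant]).

    Closed measures of small deviation are close to mu0. Since <k, V> is not 0,
    every wave cos(2 pi <k, x> + a) is the derivative along V of another wave.
    Closedness, where v replaces V, then bounds its mean by the deviation, so
    the mean of each trigonometric polynomial differs from its Haar mean by at
    most a constant times the deviation ([trig_poly_mean]). No duality is used
    to pass from there to the Wasserstein distance: an explicit coupling is
    written down. Bernstein's weights, evaluated at affine functions of the
    cosines and sines of the coordinates, form a partition of unity by positive
    trigonometric polynomials, each concentrated near one point of the torus
    ([word_variance], [dist_torus_features]). When two measures give nearly the
    same mass to each of these finitely many cells, almost all the mass can be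
    rearranged inside the cells ([cell_coupling], [close_coupling]).

    Consequently the distance from Mather measures of H + e f to mu0 tends to 0
    with e, and the infimum of its uniform bounds is a modulus
    ([exists_modulus]). A Mather measure of H has deviation 0, so its coupling
    cost to mu0 is arbitrarily small; Lipschitz functions have then equal
    integrals for both measures, which are equal ([eq_measure_closed]). The
    measure mu0 is constructed from the law of a sum of the t_i e_i with
    independent uniform t_i ([haar_box], [exists_closed_measure]). *)

Set Implicit Arguments.
Unset Strict Implicit.
Unset Printing Implicit Defensive.

Local Open Scope classical_set_scope.
Local Open Scope ring_scope.

(** * The torus and the Euclidean structure *)

Lemma tproj_eqP (R : realType) (n : nat) (x y : 'rV[R]_n) :
  tproj x = tproj y <-> forall i, (x 0 i - y 0 i) \is a Num.int.
Proof.
split=> [/eqmodP/forallP //|h]; apply/eqmodP; exact/forallP.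
Qed.

Lemma repr_tproj (R : realType) (n : nat) (x : 'rV[R]_n) i :
  (repr (tproj x) 0 i - x 0 i) \is a Num.int.
Proof. by apply: (proj1 (tproj_eqP _ _)); rewrite /tproj reprK. Qed.

Lemma tproj_repr (R : realType) (n : nat) (x : torus R n) : tproj (repr x) = x.
Proof. exact: reprK. Qed.

Lemma continuous_torusP (R : realType) (n : nat) (Z : topologicalType)
    (g : torus R n -> Z) : continuous g <-> continuous (g \o @tproj R n).
Proof. exact: quotient_continuous. Qed.

Lemma continuous_tproj (R : realType) (n : nat) : continuous (@tproj R n).
Proof. exact: pi_continuous. Qed.

Section dot.
Context {R : realType} {n : nat}.
Implicit Types (u v w x : 'rV[R]_n).

Lemma dotC u v : dot u v = dot v u.
Proof. by apply: eq_bigr => i _; rewrite mulrC. Qed.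

Lemma dotDr u v w : dot u (v + w) = dot u v + dot u w.
Proof. by rewrite -big_split; apply: eq_bigr => i _; rewrite mxE mulrDr. Qed.

Lemma dotZr u c v : dot u (c *: v) = c * dot u v.
Proof. by rewrite mulr_sumr; apply: eq_bigr => i _; rewrite mxE mulrCA. Qed.

Lemma dotNr u v : dot u (- v) = - dot u v.
Proof. by rewrite -scaleN1r dotZr mulN1r. Qed.

Lemma dotBr u v w : dot u (v - w) = dot u v - dot u w.
Proof. by rewrite dotDr dotNr. Qed.

Lemma dotDl u v w : dot (u + v) w = dot u w + dot v w.
Proof. by rewrite dotC dotDr !(dotC w). Qed.

Lemma dotNl u v : dot (- u) v = - dot u v.
Proof. by rewrite dotC dotNr dotC. Qed.

Lemma dot0r u : dot u 0 = 0.
Proof. by rewrite -(scale0r 0) dotZr mul0r. Qed.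

Lemma dot0l u : dot 0 u = 0.
Proof. by rewrite dotC dot0r. Qed.

Lemma dot_deltal i u : dot (delta_mx 0 i) u = u 0 i.
Proof.
rewrite /dot (bigD1 i)//= big1 => [|j ji]; first by rewrite mxE !eqxx mul1r addr0.
by rewrite mxE eqxx/= (negbTE ji) mul0r.
Qed.

Lemma dot_deltar i u : dot u (delta_mx 0 i) = u 0 i.
Proof. by rewrite dotC dot_deltal. Qed.

Lemma differentiable_dot u x : differentiable (dot u) x.
Proof.
rewrite (_ : dot u = \sum_(i < n) (u 0 i *: (fun y : 'rV[R]_n => y 0 i : R^o))).
  apply: differentiable_sum => i; apply: differentiableZ.
  exact: differentiable_coord.
by apply/funext => y; rewrite fct_sumE.
Qed.

Lemma continuous_dot u : continuous (dot u).
Proof. by move=> x; apply: differentiable_continuous; exact: differentiable_dot. Qed.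

Lemma derive_dot u x v : 'D_v (dot u) x = dot u v.
Proof.
rewrite /derive; apply: cvg_lim => //; apply: cvg_near_cst.
near=> h; rewrite /= dotDr dotZr addrK /GRing.scale/= mulKf//.
by near: h; exact: nbhs_dnbhs_neq.
Unshelve. all: by end_near. Qed.

End dot.

Lemma dot_grad (R : realType) (n : nat) (g : 'rV[R]_n -> R) (x v : 'rV[R]_n) :
  differentiable g x -> dot (grad g x) v = 'D_v g x.
Proof.
move=> dg; rewrite deriveE// [in RHS](row_sum_delta v) linear_sum.
apply: eq_bigr => i _; rewrite linearZ/= !mxE mulrC deriveE//.
Qed.

Lemma derive_comp_real (R : realType) (V : normedModType R) (f : V -> R)
    (g : R -> R) (x v : V) :
  differentiable f x -> derivable g (f x) 1 ->
  'D_v (g \o f) x = 'D_v f x * (g^`()%classic) (f x).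
Proof.
move=> df /derivable1_diffP dg.
rewrite deriveE; last exact: differentiable_comp.
by rewrite diff_comp//= [in RHS]deriveE// deriv1E//; apply/derivable1_diffP.
Qed.

(** * Trigonometric polynomials on the torus *)

Lemma cosD2pi_int (R : realType) (a z : R) : z \is a Num.int ->
  cos (a + 2 * pi * z) = cos a.
Proof.
have nat_case (b : R) (m : nat) : cos (b + 2 * pi * m%:R) = cos b.
  rewrite -[RHS](periodicn (@cosD2pi R) m); congr (cos (_ + _)).
  by rewrite -mulrnA -[RHS]mulr_natr natrM; ring.
case: (leP 0 z) => [z0|/ltW z0] zi.
  by move: zi; rewrite intrEge0// => /natrP[m ->].
have : - z \is a Num.int by rewrite rpredN.
rewrite intrEge0 ?oppr_ge0// => /natrP[m /eqP]; rewrite eqr_oppLR => /eqP ->.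
by rewrite mulrN -[LHS](nat_case _ m) subrK.
Qed.


Lemma dot_int (R : realType) (n : nat) (k : 'rV[int]_n) (d : 'rV[R]_n) :
  (forall i, d 0 i \is a Num.int) -> dot (map_mx intr k) d \is a Num.int.
Proof.
by move=> di; apply: rpred_sum => i _; rewrite rpredM// mxE intr_int.
Qed.

(** The phase [a] covers both the cosine and the sine of the frequency [k]. *)
Definition wave {R : realType} {n : nat} (k : 'rV[int]_n) (a : R)
    (x : torus R n) : R :=
  cos (2 * pi * dot (map_mx intr k) (repr x) + a).

(** An integral frequency makes the representative of the point irrelevant. *)
Lemma wave_tproj (R : realType) (n : nat) (k : 'rV[int]_n) (a : R) (x : 'rV_n) :
  wave k a (tproj x) = cos (2 * pi * dot (map_mx intr k) x + a).
Proof.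
rewrite /wave -(subrKC x (repr _)) dotDr mulrDr addrAC cosD2pi_int//.
by apply: dot_int => i; rewrite mxE mxE repr_tproj.
Qed.

Lemma continuous_phase_angle (R : realType) (n : nat) (k : 'rV[R]_n) (a : R) :
  continuous (fun x => 2 * pi * dot k x + a).
Proof.
move=> x; apply: (@continuousD _ _ _ (fun x => 2 * pi * dot k x) (cst a)).
  apply: (@continuousM _ _ (cst (2 * pi)) (dot k)); first exact: cst_continuous.
  exact: continuous_dot.
exact: cst_continuous.
Qed.

Lemma continuous_wave (R : realType) (n : nat) (k : 'rV[int]_n) (a : R) :
  continuous (wave k a).
Proof.
apply/continuous_torusP.
rewrite (_ : _ \o _ = cos \o (fun x => 2 * pi * dot (map_mx intr k) x + a)).
  move=> x; apply: continuous_comp; [exact: continuous_phase_angle|].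
  exact: continuous_cos.
by apply/funext => x /=; rewrite wave_tproj.
Qed.

Lemma waveM (R : realType) (n : nat) (k l : 'rV[int]_n) (a b : R) x :
  wave k a x * wave l b x =
  2^-1 * wave (k + l) (a + b) x + 2^-1 * wave (k - l) (a - b) x.
Proof.
rewrite /wave !raddfD/= raddfN/= !dotDl dotNl.
set A := dot _ _; set B := dot _ _.
rewrite (_ : 2 * pi * (A + B) + (a + b) =
  (2 * pi * A + a) + (2 * pi * B + b)); last by ring.
rewrite (_ : 2 * pi * (A - B) + (a - b) =
  (2 * pi * A + a) - (2 * pi * B + b)); last by ring.
by move: (2 * pi * A + a) (2 * pi * B + b) => {A B} A B; rewrite cosD cosB; field.
Qed.

(** Finite combinations of waves, given by generators: stability under products
    and estimates linear in the function are then proved by induction. *)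
Inductive trig_poly {R : realType} {n : nat} : (torus R n -> R) -> Prop :=
| trig_wave k a : trig_poly (wave k a)
| trigD p q : trig_poly p -> trig_poly q -> trig_poly (fun x => p x + q x)
| trigZ c p : trig_poly p -> trig_poly (fun x => c * p x).

Section trig_poly_theory.
Context {R : realType} {n : nat}.
Implicit Types p q : torus R n -> R.

Lemma trig_ext p q : p =1 q -> trig_poly p -> trig_poly q.
Proof. by move=> /funext ->. Qed.

Lemma trig_cst (c : R) : trig_poly (fun _ : torus R n => c).
Proof.
apply: (trig_ext _ (trigZ c (trig_wave 0 0))) => x.
by rewrite /wave raddf0/= dot0l mulr0 addr0 cos0 mulr1.
Qed.

Lemma trigM p q : trig_poly p -> trig_poly q -> trig_poly (fun x => p x * q x).
Proof.
move=> Hp; elim: Hp q => [k a q|p1 p2 _ IH1 _ IH2 q Hq|c p' _ IH q Hq].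
- elim => [l b|q1 q2 _ H1 _ H2|c q' _ H].
  + apply: trig_ext (fun x => esym (waveM k l a b x)) _.
    by apply: trigD; apply: trigZ; exact: trig_wave.
  + by apply: trig_ext (trigD H1 H2) => x; rewrite mulrDr.
  + by apply: trig_ext (trigZ c H) => x; rewrite mulrCA.
- by apply: trig_ext (trigD (IH1 _ Hq) (IH2 _ Hq)) => x; rewrite mulrDl.
- by apply: trig_ext (trigZ c (IH _ Hq)) => x; rewrite mulrA.
Qed.

Lemma trig_prod (I : finType) (p : I -> torus R n -> R) :
  (forall i, trig_poly (p i)) -> trig_poly (fun x => \prod_i p i x).
Proof.
move=> Hp; elim: (index_enum I) => [|i s IH].
  by apply: trig_ext (trig_cst 1) => x; rewrite big_nil.
by apply: trig_ext (trigM (Hp i) IH) => x; rewrite big_cons.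
Qed.

Lemma continuous_trig p : trig_poly p -> continuous p.
Proof.
elim => [k a|p1 p2 _ H1 _ H2|c p' _ H] x; first exact: continuous_wave.
  by apply: (@continuousD _ _ _ p1 p2); [exact: H1|exact: H2].
by apply: (@continuousM _ _ (cst c) p'); [exact: cst_continuous|exact: H].
Qed.

Lemma bounded_trig p : trig_poly p -> exists M, forall x, `|p x| <= M.
Proof.
elim => [k a|p1 p2 _ [M1 H1] _ [M2 H2]|c p' _ [M H]].
- by exists 1 => x; exact: cos_max.
- by exists (M1 + M2) => x; rewrite (le_trans (ler_normD _ _))// lerD.
- by exists (`|c| * M) => x; rewrite normrM ler_wpM2l.
Qed.

End trig_poly_theory.

(** * Borel measurability of continuous and lower semicontinuous functions *)

Section generated_sigma_algebra.
Context {T : pointedType} (G : set (set T)) {R : realType}.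

Lemma measurable_fun_real_rays (f : T -> R) :
  (forall a : R, G [set x | a < f x]) ->
  measurable_fun setT (f : g_sigma_algebraType G -> R).
Proof.
move=> Gf; apply: (measurability _ (measurable_realfun.RGenOInfty.measurableE R)).
move=> /= _ [_ [a ->]] <-; rewrite setTI; apply: sub_gen_smallest.
by rewrite (_ : _ @^-1` _ = [set x | a < f x])//; apply/seteqP; split => x /=;
  rewrite in_itv/= andbT.
Qed.

Lemma measurable_fun_ereal_rays (f : T -> \bar R) :
  (forall a : R, G [set x | (a%:E < f x)%E]) ->
  measurable_fun setT (f : g_sigma_algebraType G -> \bar R).
Proof.
move=> Gf; apply: (measurability _ (measurable_realfun.ErealGenOInfty.measurableE R)).
move=> /= _ [_ [a ->]] <-; rewrite setTI; apply: sub_gen_smallest.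
by rewrite preimage_itvoy; exact: Gf.
Qed.

Lemma measurable_fun_generated (S : pointedType) (H : set (set S)) (f : T -> S) :
  (forall A, H A -> G (f @^-1` A)) ->
  measurable_fun setT (f : g_sigma_algebraType G -> g_sigma_algebraType H).
Proof.
move=> Gf; apply: (@measurability _ _ (g_sigma_algebraType G)
  (g_sigma_algebraType H) setT f H); first by [].
by move=> _ [A HA <-]; rewrite setTI; apply: sub_gen_smallest; exact: Gf.
Qed.

End generated_sigma_algebra.

Lemma open_gt_continuous (R : realType) (T : topologicalType) (f : T -> R) a :
  continuous f -> open [set x | a < f x].
Proof.
move=> cf; rewrite (_ : mkset _ = f @^-1` [set y | a < y])//.
by apply: open_comp; [move=> x _; exact: cf|exact: open_gt].
Qed.

Lemma continuous_measurable_phase (R : realType) (n : nat) (f : phase R n -> R) :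
  continuous f -> measurable_fun setT (f : borel_phase R n -> R).
Proof.
by move=> cf; apply: measurable_fun_real_rays => a; exact: open_gt_continuous.
Qed.

(** * Closed measures and their deviation from a constant velocity *)

Definition l1norm {R : realType} {n : nat} (w : 'rV[R]_n) : R :=
  \sum_i `|w 0 i|.

Section norms.
Context {R : realType} {n : nat}.
Implicit Types w v : 'rV[R]_n.

Lemma l1norm_ge0 w : 0 <= l1norm w.
Proof. by apply: sumr_ge0. Qed.

Lemma enorm_ge0 w : 0 <= enorm w.
Proof. exact: sqrtr_ge0. Qed.

Lemma dotvv_ge0 w : 0 <= dot w w.
Proof. by apply: sumr_ge0 => i _; rewrite -expr2 sqr_ge0. Qed.

Lemma coord_le_enorm w i : `|w 0 i| <= enorm w.
Proof.
rewrite -sqrtr_sqr ler_wsqrtr// /dot (bigD1 i)//= -expr2 lerDl.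
by apply: sumr_ge0 => j _; rewrite -expr2 sqr_ge0.
Qed.

Lemma l1norm_le_enorm w : l1norm w <= n%:R * enorm w.
Proof.
have -> : n%:R * enorm w = \sum_(i < n) enorm w.
  by rewrite sumr_const card_ord mulr_natl.
by apply: ler_sum => i _; exact: coord_le_enorm.
Qed.

Lemma sum_sqr_le_sqr_sum (I : Type) (s : seq I) (F : I -> R) :
  (forall i, 0 <= F i) -> \sum_(i <- s) F i ^+ 2 <= (\sum_(i <- s) F i) ^+ 2.
Proof.
move=> F0; elim: s => [|i s IH]; first by rewrite !big_nil expr0n.
rewrite !big_cons sqrrD (le_trans (lerD (lexx _) IH))// addrAC lerDl.
by rewrite mulrn_wge0// mulr_ge0// sumr_ge0.
Qed.

Lemma enorm_le_l1norm w : enorm w <= l1norm w.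
Proof.
rewrite -[leRHS]ger0_norm ?l1norm_ge0// -sqrtr_sqr ler_wsqrtr//.
have := @sum_sqr_le_sqr_sum _ (index_enum 'I_n) (fun i => `|w 0 i|) (fun=> normr_ge0 _).
by apply: le_trans; apply: ler_sum => i _; rewrite real_normK ?num_real// expr2.
Qed.

Lemma l1normD w v : l1norm (w + v) <= l1norm w + l1norm v.
Proof.
by rewrite -big_split/=; apply: ler_sum => i _; rewrite mxE ler_normD.
Qed.

Lemma l1normN w : l1norm (- w) = l1norm w.
Proof. by apply: eq_bigr => i _; rewrite mxE normrN. Qed.

Lemma dot_le_l1norm w v : `|dot w v| <= enorm w * l1norm v.
Proof.
rewrite mulr_sumr (le_trans (ler_norm_sum _ _ _))// ler_sum// => i _.
by rewrite normrM ler_wpM2r// coord_le_enorm.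
Qed.

Lemma continuous_coord i : continuous (fun w : 'rV[R]_n => w 0 i).
Proof.
rewrite (_ : (fun w => _) = dot (delta_mx 0 i)); first exact: continuous_dot.
by apply/funext => w; rewrite dot_deltal.
Qed.

End norms.

Lemma continuous_bigsum (R : realType) (T : topologicalType) (I : Type)
    (s : seq I) (F : I -> T -> R) :
  (forall i, continuous (F i)) -> continuous (fun x => \sum_(i <- s) F i x).
Proof.
move=> cF; elim: s => [|i s IH] x.
  by under eq_fun do rewrite big_nil; exact: cst_continuous.
under eq_fun do rewrite big_cons.
by apply: (@continuousD _ _ _ (F i)); [exact: cF|exact: IH].
Qed.

Lemma continuous_l1norm (R : realType) (n : nat) : continuous (@l1norm R n).
Proof.
apply: continuous_bigsum => i x.
by apply: (@continuous_comp _ _ _ (fun w : 'rV[R]_n => w 0 i) Num.norm);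
  [exact: continuous_coord|exact: norm_continuous].
Qed.

Lemma continuous_enorm (R : realType) (n : nat) : continuous (@enorm R n).
Proof.
move=> w; apply: (@continuous_comp _ _ _ (fun w : 'rV[R]_n => dot w w) Num.sqrt).
  apply: continuous_bigsum => i x.
  by apply: (@continuousM _ _ (fun w : 'rV[R]_n => w 0 i));
    exact: continuous_coord.
exact: sqrt_continuous.
Qed.

Section phase.
Context {R : realType} {n : nat}.

Lemma continuous_pos (Z : topologicalType) (g : torus R n -> Z) :
  continuous g -> continuous (fun z : phase R n => g z.1).
Proof.
move=> cg z; apply: (@continuous_comp _ _ _ (fst : phase R n -> _) g);
  [exact: cvg_fst|exact: cg].
Qed.

Lemma continuous_vel (Z : topologicalType) (g : 'rV[R]_n -> Z) :
  continuous g -> continuous (fun z : phase R n => g z.2).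
Proof.
move=> cg z; apply: (@continuous_comp _ _ _ (snd : phase R n -> _) g);
  [exact: cvg_snd|exact: cg].
Qed.

(** The l1 norm is dual to the sup norm of momenta: it comes out of the Legendre
    transform evaluated at momenta with all coordinates equal to s or -s. *)
Definition velocity_gap (V : 'rV[R]_n) (z : phase R n) : R := l1norm (z.2 - V).

Lemma continuous_velocity_gap V : continuous (velocity_gap V).
Proof.
apply: (@continuous_vel _ (fun w => l1norm (w - V))) => w.
apply: (@continuous_comp _ _ _ (fun w : 'rV[R]_n => w - V) (@l1norm R n)); last exact: continuous_l1norm.
by apply: (@continuousD _ _ _ id (cst (- V))); [exact: id|exact: cst_continuous].
Qed.

End phase.

Section integration.
Context d (T : measurableType d) (R : realType) (P : probability T R).

Lemma bounded_integrable (f : T -> R) (M : R) :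
  measurable_fun setT f -> (forall x, `|f x| <= M) ->
  P.-integrable setT (EFin \o f).
Proof.
move=> mf fM; apply: measurable_bounded_integrable => //.
  by rewrite ltey_eq fin_num_measure.
exists M; split; first exact: num_real.
by move=> x Mx y _; apply: le_trans (fM y) _; exact: ltW.
Qed.

Lemma Rintegral_cst_prob (c : R) : \int[P]_x c = c.
Proof. by rewrite Rintegral_cst// [X in fine X](probability_setT P) mulr1. Qed.

End integration.

Definition deviation {R : realType} {n : nat} (V : 'rV[R]_n)
  (nu : probability (borel_phase R n) R) : R := \int[nu]_z velocity_gap V z.

Section closed.
Context {R : realType} {n : nat} (V : 'rV[R]_n).
Implicit Types nu : probability (borel_phase R n) R.

Lemma integrable_enorm nu : closed_measure nu ->
  nu.-integrable setT (fun z => (enorm z.2)%:E).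
Proof.
move=> [fin _]; apply/integrableP; split.
  apply/measurable_EFinP; apply: (@continuous_measurable_phase R n (fun z => enorm z.2)).
  by apply: continuous_vel; exact: continuous_enorm.
by under eq_integral do rewrite gee0_abs ?lee_fin ?enorm_ge0//.
Qed.

Lemma measurable_velocity_gap : measurable_fun setT (velocity_gap V : borel_phase R n -> R).
Proof.
by apply: continuous_measurable_phase; exact: continuous_velocity_gap.
Qed.

Lemma integrable_velocity_gap nu : closed_measure nu ->
  nu.-integrable setT (EFin \o velocity_gap V).
Proof.
move=> nuc.
have i1 : nu.-integrable setT
    ((fun z => n%:R%:E * (enorm z.2)%:E) \+ (EFin \o cst (l1norm V)))%E.
  apply: integrableD => //; last exact: finite_measure_integrable_cst.
  by apply: integrableZl => //; exact: integrable_enorm.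
apply: le_integrable i1 => //; first by apply/measurable_EFinP; exact: measurable_velocity_gap.
move=> z _ /=; rewrite lee_fin ger0_norm ?l1norm_ge0// ger0_norm; last first.
  by rewrite addr_ge0 ?l1norm_ge0// mulr_ge0// enorm_ge0.
by rewrite (le_trans (l1normD _ _))// l1normN lerD2r l1norm_le_enorm.
Qed.

Lemma deviation_ge0 nu : 0 <= deviation V nu.
Proof. by apply: Rintegral_ge0 => z _; exact: l1norm_ge0. Qed.

End closed.

(** * Nonresonant averages of trigonometric polynomials *)

Section wave_derivative.
Context {R : realType} {n : nat} (k : 'rV[int]_n) (b : R).
Local Notation kR := (map_mx intr k : 'rV[R]_n).
Let ang (x : 'rV[R]_n) : R := 2 * pi * dot kR x + b.

Let differentiable_ang x : differentiable ang x.
Proof.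
apply: (@differentiableD _ _ _ (fun x => 2 * pi * dot kR x) (cst b)) => //.
by apply: (@differentiableZ _ _ _ (dot kR)); exact: differentiable_dot.
Qed.

Let derive_ang x v : 'D_v ang x = 2 * pi * dot kR v.
Proof.
have dd : derivable (dot kR) x v by apply: diff_derivable; exact: differentiable_dot.
rewrite (@deriveD _ _ _ (fun x => 2 * pi * dot kR x) (cst b))//; last first.
  exact: (@derivableZ _ _ _ (dot kR)).
by rewrite derive_cst addr0 (@deriveZ _ _ _ (dot kR))// derive_dot.
Qed.

Let wave_ang : wave k b \o @tproj R n = cos \o ang.
Proof. by apply/funext => x /=; rewrite wave_tproj. Qed.

Let derivable_cos1 (y : R) : derivable cos y 1. Proof. exact: derivable_cos. Qed.

Lemma derive_wave x v : 'D_v (wave k b \o @tproj R n) x =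
  2 * pi * dot kR v * - sin (2 * pi * dot kR x + b).
Proof.
rewrite wave_ang derive_comp_real// derive_ang derive1E.
by rewrite (@derive_val _ _ _ _ _ _ _ (is_derive_cos _)).
Qed.

Lemma C1_wave : C1_torus (wave k b).
Proof.
split=> [x|v].
  rewrite wave_ang; apply: differentiable_comp => //.
  exact/derivable1_diffP.
rewrite (_ : 'D_v _ = (fun x => 2 * pi * dot kR v * - sin (ang x))).
  move=> x; apply: (@continuousM _ _ (cst (2 * pi * dot kR v)) (fun x => - sin (ang x))).
    exact: cst_continuous.
  apply: (@continuousN _ _ _ (sin \o ang)); apply: (@continuous_comp _ _ _ ang).
    exact: continuous_phase_angle.
  exact: continuous_sin.
by apply/funext => x; rewrite derive_wave.
Qed.

Lemma dot_dtorus_wave x v : dot (dtorus (wave k b) x) v =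
  2 * pi * dot kR v * - sin (2 * pi * dot kR (repr x) + b).
Proof. by rewrite /dtorus dot_grad ?derive_wave//; case: C1_wave. Qed.

End wave_derivative.

Section equidistribution.
Context {R : realType} {n : nat} (V : 'rV[R]_n).
Implicit Types nu : probability (borel_phase R n) R.

Lemma integrable_linear_growth nu (W : 'rV[R]_n) (f : phase R n -> R) (c M : R) :
  closed_measure nu -> continuous f ->
  (forall z, `|f z| <= c * velocity_gap W z + M) ->
  nu.-integrable setT (EFin \o f).
Proof.
move=> nuc cf fle.
have i1 : nu.-integrable setT
    ((fun z => c%:E * (velocity_gap W z)%:E) \+ (EFin \o cst M))%E.
  apply: integrableD => //; last exact: finite_measure_integrable_cst.
  by apply: integrableZl => //; exact: integrable_velocity_gap.
apply: le_integrable i1 => //.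
  by apply/measurable_EFinP; exact: continuous_measurable_phase.
move=> z _ /=; rewrite lee_fin; apply: le_trans (fle z) _.
exact: ler_norm.
Qed.

(** The wave delayed by a quarter of a period has derivative
    2 pi <k, v> wave(k, a) along v. Closedness says that <k, v> wave(k, a) has
    mean zero, and replacing v by V costs at most the deviation. *)
Lemma wave_mean_le nu (k : 'rV[int]_n) (a : R) : closed_measure nu ->
  `|dot (map_mx intr k) V * \int[nu]_z wave k a z.1| <=
    enorm (map_mx intr k : 'rV[R]_n) * deviation V nu.
Proof.
move=> nuc; set kR := map_mx intr k.
have cwave : continuous (fun z : phase R n => wave k a z.1).
  by apply: (@continuous_pos R n _ (wave k a)); exact: continuous_wave.
have wave1 z : `|wave k a z| <= 1 by exact: cos_max.
have cdot (w : 'rV[R]_n) : continuous (fun z : phase R n => dot kR (w - z.2) * wave k a z.1).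
  move=> z; apply: (@continuousM _ _ (fun z : phase R n => dot kR (w - z.2)) (fun z => wave k a z.1)).
    apply: (@continuous_vel R n _ (fun v => dot kR (w - v))) => v.
    apply: (@continuous_comp _ _ _ (fun v : 'rV[R]_n => w - v) (dot kR)).
      by apply: (@continuousB _ _ _ (cst w) id); [exact: cst_continuous|exact: id].
    exact: continuous_dot.
  exact: cwave.
have idot w : nu.-integrable setT (EFin \o (fun z => dot kR (w - z.2) * wave k a z.1)).
  apply: (@integrable_linear_growth nu w _ (enorm kR) 0) => // z.
  rewrite normrM addr0 (le_trans (ler_wpM2l _ (wave1 _)))// mulr1.
  by rewrite (le_trans (dot_le_l1norm _ _))// -l1normN opprB.
have closed0 : \int[nu]_z (dot kR (0 - z.2) * wave k a z.1) = 0.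
  have := nuc.2 _ (C1_wave k (a - pi / 2)).
  rewrite /Rintegral.
  set I := (X in X = 0%E -> _).
  have -> : I = ((- (2 * pi))%:E *
      \int[nu]_z (dot kR (0 - z.2) * wave k a z.1)%:E)%E.
    rewrite /I -integralZl//; last exact: idot.
    apply: eq_integral => z _.
    rewrite dot_dtorus_wave addrA sinBpihalf opprK -/kR -EFinM; congr EFin.
    by rewrite dotBr dot0r /wave; ring.
  move=> /eqP; rewrite mule_eq0 eqe oppr_eq0 mulf_eq0 pnatr_eq0/=.
  by rewrite gt_eqF ?pi_gt0// => /eqP ->.
have -> : dot kR V * \int[nu]_z wave k a z.1 =
    \int[nu]_z (dot kR (V - z.2) * wave k a z.1).
  rewrite -RintegralZl//; last first.
    apply: (@integrable_linear_growth nu V _ 0 1) => // z.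
    by rewrite mul0r add0r.
  rewrite -[LHS]addr0 -closed0 -RintegralD//.
    by apply: eq_Rintegral => z _; rewrite !dotBr dot0r; ring.
  apply: (@integrable_linear_growth nu V (fun z => dot kR V * wave k a z.1) 0 `|dot kR V|) => [//| |z].
    move=> z; apply: (@continuousM _ _ (cst (dot kR V)) (fun z : phase R n => wave k a z.1)); last exact: cwave.
    exact: cst_continuous.
  by rewrite normrM mul0r add0r ler_piMr.
rewrite (le_trans (le_normr_Rintegral _ _))// -RintegralZl//; last first.
  exact: integrable_velocity_gap.
apply: le_Rintegral => //.
- exact: integrable_norm.
- exact: (integrableZl measurableT (enorm kR) (integrable_velocity_gap V nuc)).
- move=> z _; rewrite normrM (le_trans (ler_wpM2l _ (wave1 _)))// mulr1.
  by rewrite (le_trans (dot_le_l1norm _ _))// /velocity_gap -l1normN opprB.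
Qed.

Hypothesis nonresonant :
  forall k : 'rV[int]_n, k != 0 -> dot (map_mx intr k) V != 0.

(** The constant [c] is the Haar mean of [p]; the small divisors <k, V> appear in
    [K] only. *)
Lemma trig_poly_mean (p : torus R n -> R) : trig_poly p ->
  exists c K, 0 <= K /\ forall nu, closed_measure nu ->
    `|\int[nu]_z p z.1 - c| <= K * deviation V nu.
Proof.
have integrable_trig q nu : trig_poly q ->
    nu.-integrable setT (EFin \o (fun z => q z.1)).
  move=> tq; have [M qM] := bounded_trig tq.
  apply: (@bounded_integrable _ _ _ nu _ M) => //.
  apply: continuous_measurable_phase.
  by apply: (@continuous_pos R n _ q); exact: continuous_trig.
elim => [k a|p1 p2 t1 [c1 [K1 [K10 H1]]] t2 [c2 [K2 [K20 H2]]]|c q tq [c1 [K1 [K10 H1]]]].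
- have [->|k0] := eqVneq k 0.
    exists (cos a), 0; split => // nu _.
    under eq_Rintegral do rewrite /wave raddf0/= dot0l mulr0 add0r.
    by rewrite Rintegral_cst_prob subrr normr0 mul0r.
  exists 0, (enorm (map_mx intr k : 'rV[R]_n) / `|dot (map_mx intr k) V|).
  have d0 : 0 < `|dot (map_mx intr k) V| by rewrite normr_gt0 nonresonant.
  split; first by rewrite divr_ge0// enorm_ge0.
  move=> nu nuc; rewrite subr0 mulrAC ler_pdivlMr// mulrC -normrM.
  exact: wave_mean_le.
- exists (c1 + c2), (K1 + K2); split; first exact: addr_ge0.
  move=> nu nuc; rewrite RintegralD//; try exact: integrable_trig.
  rewrite opprD addrACA mulrDl (le_trans (ler_normD _ _))// lerD//.
    exact: H1.
  exact: H2.
- exists (c * c1), (`|c| * K1); split; first exact: mulr_ge0.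
  move=> nu nuc; rewrite RintegralZl//; last exact: integrable_trig.
  by rewrite -mulrBr normrM -mulrA ler_wpM2l// H1.
Qed.

End equidistribution.

(** * Random words *)

Definition coin_weight {R : realType} (u : R) (b : bool) : R :=
  if b then u else 1 - u.

(** The probability of the word [s] when its letters are independent, the
    letter [c] being [true] with probability [w c]. As functions of [w] these
    weights form a partition of unity by polynomials, Bernstein's partition with
    the words of equal letter count kept apart. *)
Definition word_weight {R : realType} {C : finType} (w : C -> R)
    (s : {ffun C -> bool}) : R := \prod_c coin_weight (w c) (s c).

Lemma sum_word_weightM (R : realType) (C : finType) (w : C -> R)
    (h : C -> bool -> R) :
  \sum_s word_weight w s * \prod_c h c (s c) =
  \prod_c (w c * h c true + (1 - w c) * h c false).
Proof.
under [RHS]eq_bigr => c _.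
  rewrite (_ : _ + _ = \sum_(b : bool) coin_weight (w c) b * h c b); last first.
    by rewrite big_bool.
  over.
rewrite bigA_distr_bigA/=; apply: eq_bigr => s _.
by rewrite /word_weight -big_split.
Qed.

Lemma sum_word_weight (R : realType) (C : finType) (w : C -> R) :
  \sum_s word_weight w s = 1.
Proof.
rewrite -[RHS](_ : \prod_c (w c * 1 + (1 - w c) * 1) = 1); last first.
  by rewrite big1// => c _; rewrite !mulr1 subrKC.
rewrite -(sum_word_weightM w (fun _ _ => 1)); apply: eq_bigr => s _.
by rewrite big1_eq mulr1.
Qed.

(** Distinct letters are independent, so the product of their centred values has
    mean zero. *)
Lemma word_covariance (R : realType) (C : finType) (w : C -> R) (c d : C) :
  \sum_s word_weight w s * (((s c)%:R - w c) * ((s d)%:R - w d)) =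
  if c == d then w c * (1 - w c) else 0.
Proof.
pose h e (b : bool) : R := (if e == c then b%:R - w c else 1) *
  (if e == d then b%:R - w d else 1).
have -> : \sum_s word_weight w s * (((s c)%:R - w c) * ((s d)%:R - w d)) =
    \sum_s word_weight w s * \prod_e h e (s e).
  apply: eq_bigr => s _; congr *%R.
  by rewrite big_split/= -!big_mkcond/= !big_pred1_eq.
rewrite sum_word_weightM (bigD1 c)//= /h eqxx.
have [<-{d h}|cd] := eqVneq c d.
  rewrite big1 => [|e ec]; last by rewrite (negbTE ec); lra.
  by rewrite /=; ring.
by rewrite [X in X * _](_ : _ = 0) ?mul0r//=; ring.
Qed.

Definition letter_frequency {R : realType} {L : finType} {M : nat}
    (s : {ffun L * 'I_M -> bool}) (l : L) : R :=
  M%:R^-1 * \sum_(i < M) (s (l, i))%:R.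

(** The weak law of large numbers: the weights concentrate, at rate 1/M, on the
    words whose letter frequencies approximate the given probabilities. *)
Lemma word_variance (R : realType) (L : finType) (M : nat) (u : L -> R) (l : L) :
  (0 < M)%N ->
  \sum_(s : {ffun L * 'I_M -> bool})
     word_weight (fun c => u c.1) s * (letter_frequency s l - u l) ^+ 2 =
  u l * (1 - u l) / M%:R.
Proof.
move=> M0; have Mn0 : M%:R != 0 :> R by rewrite pnatr_eq0 -lt0n.
have dev (s : {ffun L * 'I_M -> bool}) : (letter_frequency s l - u l) ^+ 2 =
    M%:R^-2 * \sum_(i < M) \sum_(j < M)
      (((s (l, i))%:R - u l) * ((s (l, j))%:R - u l)).
  have -> : letter_frequency s l - u l =
      M%:R^-1 * \sum_(i < M) ((s (l, i))%:R - u l).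
    rewrite sumrB mulrBr sumr_const card_ord; congr (_ - _).
    by rewrite -[u l *+ M]mulr_natl mulKf.
  rewrite exprMn exprVn; congr *%R.
  by rewrite expr2 big_distrlr.
under eq_bigr do rewrite dev mulrCA mulr_sumr.
rewrite -mulr_sumr exchange_big/= (eq_bigr (fun=> u l * (1 - u l))).
  rewrite sumr_const card_ord -[_ *+ M]mulr_natl; field; exact: Mn0.
move=> i _; under eq_bigr do rewrite mulr_sumr.
have cov j : \sum_(s : {ffun L * 'I_M -> bool}) word_weight (fun c => u c.1) s *
    (((s (l, i))%:R - u l) * ((s (l, j))%:R - u l)) =
    if i == j then u l * (1 - u l) else 0.
  have /= -> := word_covariance (fun c : L * 'I_M => u c.1) (l, i) (l, j).
  by rewrite xpair_eqE eqxx.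
rewrite exchange_big/= (bigD1 i)//= cov eqxx big1 ?addr0// => j ji.
by rewrite cov eq_sym (negbTE ji).
Qed.

(** * Densities and bounded measurable functions *)

Section density.
Context d (T : measurableType d) (R : realType) (P : probability T R).
Variable f : T -> R.
Hypotheses (mf : measurable_fun setT f) (f0 : forall x, 0 <= f x).
Hypothesis f1 : (\int[P]_x (f x)%:E = 1)%E.

(** The properties of [f] are arguments so that the measure and probability
    structures can be attached to the set function itself. *)
Definition density_prob of measurable_fun setT f & (forall x, 0 <= f x) &
    (\int[P]_x (f x)%:E = 1)%E : set T -> \bar R :=
  fun A => (\int[P]_(x in A) (f x)%:E)%E.

Local Notation Q := (density_prob mf f0 f1).

Let Q0 : Q set0 = 0%E.
Proof. by rewrite /density_prob integral_set0. Qed.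

Let Q_ge0 A : (0 <= Q A)%E.
Proof. by apply: integral_ge0 => x _; rewrite lee_fin f0. Qed.

Let Q_sigma_additive : semi_sigma_additive Q.
Proof.
move=> /= F mF tF mUF; rewrite /density_prob; apply: cvg_toP.
  apply: ereal_nondecreasing_is_cvgn => m n mn.
  apply: lee_sum_nneg_natr => // k _ _.
  by apply: integral_ge0 => /= x _; rewrite lee_fin f0.
rewrite ge0_integral_bigcup//=.
- by apply: measurable_funTS; exact/measurable_EFinP.
- by move=> x _; rewrite lee_fin f0.
Qed.

HB.instance Definition _ := isMeasure.Build _ _ _ Q Q0 Q_ge0 Q_sigma_additive.

Let Q_setT : Q [set: _] = 1%E.
Proof. exact: f1. Qed.

HB.instance Definition _ := @Measure_isProbability.Build _ _ R Q Q_setT.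

(** The density [f] agrees almost everywhere with the Radon-Nikodym derivative,
    for which the change of variables is known. *)
Lemma integral_density_prob (h : T -> \bar R) :
  measurable_fun setT h -> (forall x, 0 <= h x)%E ->
  (\int[density_prob mf f0 f1]_x h x = \int[P]_x (h x * (f x)%:E))%E.
Proof.
move=> mh h0; have dom : Q `<< P.
  apply/null_content_dominatesP => A mA PA0; apply: null_set_integral => //.
  by apply: measurable_funTS; exact/measurable_EFinP.
pose D := Radon_Nikodym_SigmaFinite.f Q P.
have mD : measurable_fun setT D.
  exact: measurable_int (Radon_Nikodym_SigmaFinite.f_integrable dom).
rewrite -(Radon_Nikodym_SigmaFinite.change_of_variables dom h0)//.
apply: ae_eq_integral => //.
- exact: emeasurable_funM.
- by apply: emeasurable_funM => //; exact/measurable_EFinP.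
- apply: ae_eqe_mul2l; apply: integral_ae_eq => //.
  + exact: Radon_Nikodym_SigmaFinite.f_integrable.
  + exact/measurable_EFinP.
  + by move=> A _ mA; rewrite -Radon_Nikodym_SigmaFinite.f_integral.
Qed.

End density.

Definition bounded_measurable d (T : measurableType d) (R : realType)
    (f : T -> R) : Prop :=
  measurable_fun setT f /\ exists M, forall x, `|f x| <= M.

Section bounded_measurable.
Context d (T : measurableType d) (R : realType).
Implicit Types (f g : T -> R) (P : probability T R).

Lemma bmeas_cst c : bounded_measurable (fun _ : T => c : R).
Proof. by split => //; exists `|c|. Qed.

Lemma bmeasD f g : bounded_measurable f -> bounded_measurable g ->
  bounded_measurable (fun x => f x + g x).
Proof.
move=> [mf [M fM]] [mg [N gN]]; split; first exact: measurable_funD.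
by exists (M + N) => x; rewrite (le_trans (ler_normD _ _))// lerD.
Qed.

Lemma bmeasM f g : bounded_measurable f -> bounded_measurable g ->
  bounded_measurable (fun x => f x * g x).
Proof.
move=> [mf [M fM]] [mg [N gN]]; split; first exact: measurable_funM.
by exists (M * N) => x; rewrite normrM ler_pM.
Qed.

Lemma bmeasZ c f : bounded_measurable f -> bounded_measurable (fun x => c * f x).
Proof. by apply: bmeasM; exact: bmeas_cst. Qed.

Lemma bmeas_sum (I : Type) (s : seq I) (F : I -> T -> R) :
  (forall i, bounded_measurable (F i)) ->
  bounded_measurable (fun x => \sum_(i <- s) F i x).
Proof.
move=> hF; elim: s => [|i s IH].
  by under eq_fun do rewrite big_nil; exact: bmeas_cst.
by under eq_fun do rewrite big_cons; exact: bmeasD.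
Qed.

Lemma bmeas_integrable P f : bounded_measurable f ->
  P.-integrable setT (EFin \o f).
Proof. by move=> [mf [M fM]]; exact: bounded_integrable fM. Qed.

Lemma EFin_Rintegral P f : bounded_measurable f ->
  (\int[P]_x (f x)%:E = (\int[P]_x f x)%:E)%E.
Proof.
move=> bf; rewrite fineK//; apply: integrable_fin_num => //.
exact: bmeas_integrable.
Qed.

Lemma Rintegral_bigsum P (I : Type) (s : seq I) (F : I -> T -> R) :
  (forall i, bounded_measurable (F i)) ->
  \int[P]_x (\sum_(i <- s) F i x) = \sum_(i <- s) \int[P]_x F i x.
Proof.
move=> hF; elim: s => [|i s IH].
  by under eq_Rintegral do rewrite big_nil; rewrite Rintegral_cst_prob big_nil.
under eq_Rintegral do rewrite big_cons.
rewrite RintegralD// ?IH ?big_cons//; apply: bmeas_integrable => //.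
exact: bmeas_sum.
Qed.

End bounded_measurable.

(** * Coupling through a partition of unity *)

Section cell_coupling.
Context d (T : measurableType d) (R : realType) (nu mu : probability T R).
Variables (I : finType) (g : I -> T -> R) (delta : R).
Hypotheses (bg : forall i, bounded_measurable (g i))
  (g0 : forall i x, 0 <= g i x) (g1 : forall x, \sum_i g i x = 1).
Let a i := \int[mu]_x g i x.
Let b i := \int[nu]_x g i x.
Hypotheses (a_gt0 : forall i, 0 < a i) (delta1 : 0 <= delta <= 1)
  (ab : forall i, (1 - delta) * b i <= a i).

Let d1 : 0 <= 1 - delta. Proof. by case/andP: delta1; lra. Qed.

(** A point [z] is drawn from [nu], then a cell [i] with probability [g i z], then
    [w] from [mu] conditioned on the cell [i]. Scaled by [1 - delta], this leaves
    some mass of [mu] unused, since [(1 - delta) * b i <= a i]; that mass is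
    [rest] and is paired with [nu] independently. *)
Let rest (w : T) : R := 1 - (1 - delta) * \sum_i b i / a i * g i w.
Let density (zw : T * T) : R :=
  (1 - delta) * (\sum_i g i zw.1 / a i * g i zw.2) + rest zw.2.

Let rest_ge0 w : 0 <= rest w.
Proof.
rewrite subr_ge0 -[leRHS](g1 w) mulr_sumr ler_sum// => i _.
rewrite mulrA ler_piMl// mulrA ler_pdivrMr// mul1r; exact: ab.
Qed.

Let density_ge0 zw : 0 <= density zw.
Proof.
rewrite addr_ge0// mulr_ge0// sumr_ge0// => i _.
by rewrite mulr_ge0// divr_ge0// ltW.
Qed.

Let sum_b : \sum_i b i = 1.
Proof.
rewrite -Rintegral_bigsum//; under eq_Rintegral do rewrite g1.
exact: Rintegral_cst_prob.
Qed.

Let brest : bounded_measurable rest.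
Proof.
apply: bmeasD; first exact: bmeas_cst.
rewrite (_ : (fun _ => _) = fun w => - (1 - delta) * \sum_i b i / a i * g i w).
  by apply: bmeasZ; apply: bmeas_sum => i; exact: bmeasZ.
by apply/funext => w; rewrite mulNr.
Qed.

Let Rintegral_comb (P : probability T R) (c : I -> R) (f : I -> T -> R) :
  (forall i, bounded_measurable (f i)) ->
  \int[P]_x (\sum_i c i * f i x) = \sum_i c i * \int[P]_x f i x.
Proof.
move=> bf; rewrite Rintegral_bigsum => [|i]; last exact: bmeasZ.
by apply: eq_bigr => i _; rewrite RintegralZl//; exact: bmeas_integrable.
Qed.

Let Rintegral_rest : \int[mu]_w rest w = delta.
Proof.
rewrite RintegralB//; last 2 first.
- exact/bmeas_integrable/bmeas_cst.
- by apply: bmeas_integrable; apply: bmeasZ; apply: bmeas_sum => i; exact: bmeasZ.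
rewrite Rintegral_cst_prob RintegralZl//; last first.
  by apply: bmeas_integrable; apply: bmeas_sum => i; exact: bmeasZ.
rewrite Rintegral_comb// -[X in _ * X](_ : 1 = _) ?mulr1 ?subKr//.
by rewrite -sum_b; apply: eq_bigr => i _; rewrite divfK// gt_eqF.
Qed.

Let density_marginal1 z : (\int[mu]_w (density (z, w))%:E = 1)%E.
Proof.
have b1 : bounded_measurable (fun w => (1 - delta) * (\sum_i g i z / a i * g i w)).
  by apply: bmeasZ; apply: bmeas_sum => i; exact: bmeasZ.
rewrite /density/= EFin_Rintegral; last exact: bmeasD.
rewrite RintegralD ?Rintegral_rest//; try exact: bmeas_integrable.
rewrite RintegralZl//; last first.
  by apply: bmeas_integrable; apply: bmeas_sum => i; exact: bmeasZ.
rewrite Rintegral_comb// -[X in _ * X](_ : 1 = _) ?mulr1 ?subrK//.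
by rewrite -(g1 z); apply: eq_bigr => i _; rewrite divfK// gt_eqF.
Qed.

Let density_marginal2 w : (\int[nu]_z (density (z, w))%:E = 1)%E.
Proof.
have b1 : bounded_measurable (fun z => (\sum_i g i w / a i * g i z)).
  by apply: bmeas_sum => i; exact: bmeasZ.
under eq_integral => z _.
  rewrite /density/= (_ : \sum_i _ = \sum_i g i w / a i * g i z); last first.
    by apply: eq_bigr => i _; rewrite mulrC mulrA mulrAC.
  over.
rewrite EFin_Rintegral; last exact: (bmeasD (bmeasZ _ b1) (bmeas_cst _ _)).
rewrite RintegralD//; last 2 first.
- exact: (bmeas_integrable _ (bmeasZ _ b1)).
- exact: (bmeas_integrable _ (bmeas_cst _ _)).
rewrite RintegralZl//; last exact: (bmeas_integrable _ b1).
rewrite Rintegral_cst_prob Rintegral_comb//; congr EFin.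
rewrite /rest [X in X + _](_ : _ = (1 - delta) * \sum_i b i / a i * g i w).
  by rewrite addrC subrK.
by congr *%R; apply: eq_bigr => i _; rewrite mulrC mulrA mulrAC.
Qed.

Let mg i : measurable_fun setT (g i). Proof. by case: (bg i). Qed.

Let mdensity : measurable_fun setT density.
Proof.
apply: measurable_funD.
  apply: measurable_funM => //; apply: measurable_sum => i.
  apply: measurable_funM; first apply: measurable_funM => //.
    exact: (measurableT_comp (mg i) measurable_fst).
  exact: (measurableT_comp (mg i) measurable_snd).
exact: (measurableT_comp brest.1 measurable_snd).
Qed.

Let density1 : (\int[(nu \x mu)%E]_zw (density zw)%:E = 1)%E.
Proof.
rewrite fubini_tonelli1//; last first.
  by apply/measurable_EFinP; exact: mdensity.
rewrite /fubini_F; under eq_integral do rewrite density_marginal1.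
by rewrite integral_cst// mul1e; exact: probability_setT.
Qed.

Let P : probability (T * T)%type R := density_prob mdensity density_ge0 density1.

Let mindic (A : set (T * T)) : measurable A ->
  measurable_fun setT (fun x => (\1_A x : R)%:E).
Proof. by move=> mA; exact/measurable_EFinP/measurable_indic. Qed.

Let P_indic A : measurable A ->
  P A = (\int[nu]_z \int[mu]_w ((density (z, w))%:E * (\1_A (z, w))%:E))%E.
Proof.
move=> mA; have mDA : measurable_fun setT (fun x => (density x)%:E * (\1_A x)%:E)%E.
  by apply: emeasurable_funM; [by apply/measurable_EFinP; exact: mdensity|exact: mindic].
rewrite [LHS](_ : _ = \int[(nu \x mu)%E]_x ((density x)%:E * (\1_A x)%:E))%E.
  rewrite fubini_tonelli1// => x.
  by rewrite mule_ge0 ?lee_fin ?density_ge0.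
rewrite [LHS]integral_mkcond; apply: eq_integral => x _.
by rewrite patchE indicE; case: ifPn => _; rewrite ?mule1 ?mule0.
Qed.

Let marginal1 A : measurable A -> P (A `*` setT) = nu A.
Proof.
move=> mA; rewrite P_indic; last exact: measurableX.
rewrite -[X in _ = nu X]setIT -integral_indic//; apply: eq_integral => z _.
have idc w : \1_(A `*` setT) (z, w) = \1_A z :> R.
  by rewrite !indicE in_setX in_setT andbT.
under eq_integral do rewrite idc.
rewrite ge0_integralZr//.
- by rewrite density_marginal1 mul1e.
- by apply/measurable_EFinP; apply: (measurableT_comp mdensity); exact: measurable_pair1.
- by move=> w _; rewrite lee_fin density_ge0.
Qed.

Let marginal2 A : measurable A -> P (setT `*` A) = mu A.
Proof.
move=> mA; have mTA : measurable (setT `*` A : set (T * T)) by exact: measurableX.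
rewrite P_indic// (fubini_tonelli (fun zw => (density zw)%:E * (\1_(setT `*` A) zw)%:E)%E).
- rewrite -[X in _ = mu X]setIT -integral_indic//; apply: eq_integral => w _.
  have idc z : \1_(setT `*` A) (z, w) = \1_A w :> R.
    by rewrite !indicE in_setX in_setT.
  under eq_integral do rewrite idc.
  rewrite ge0_integralZr//.
  + by rewrite density_marginal2 mul1e.
  + by apply/measurable_EFinP; apply: (measurableT_comp mdensity); exact: measurable_pair2.
  + by move=> z _; rewrite lee_fin density_ge0.
- by apply: emeasurable_funM; [by apply/measurable_EFinP; exact: mdensity|exact: mindic].
- by move=> x; rewrite mule_ge0 ?lee_fin ?density_ge0.
Qed.

(** Two points in the cell [i] are at cost at most [h i z + h i w], whose mean is
    controlled by [eta] for each marginal; a mass [delta] is moved blindly, at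
    cost at most [C]. *)
Lemma cell_coupling : exists Q : probability (T * T)%type R,
  (forall A, measurable A -> Q (A `*` setT) = nu A /\ Q (setT `*` A) = mu A) /\
  forall (c : T * T -> R) (h : I -> T -> R) (C eta : R),
    measurable_fun setT c -> (forall zw, 0 <= c zw) ->
    (forall i, bounded_measurable (h i)) ->
    (forall i z w, c (z, w) <= h i z + h i w) ->
    (forall zw, c zw <= C) ->
    (forall z, \sum_i g i z * h i z <= eta) ->
    (\int[Q]_zw (c zw)%:E <= (2 * eta + delta * C)%:E)%E.
Proof.
exists P; split=> [A mA|c h C eta mc c0 bh ch cC gh].
  by rewrite marginal1// marginal2.
have h0 i z : 0 <= h i z by have := le_trans (c0 (z, z)) (ch i z z); lra.
have bgh i : bounded_measurable (fun x => g i x * h i x) by exact: bmeasM.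
pose k i := \int[mu]_x (g i x * h i x).
have k0 i : 0 <= k i by apply: Rintegral_ge0 => x _; rewrite mulr_ge0.
have sum_le (Q : probability T R) : \sum_i \int[Q]_x (g i x * h i x) <= eta.
  rewrite -Rintegral_bigsum// -[leRHS](Rintegral_cst_prob Q).
  apply: le_Rintegral => //; apply: bmeas_integrable; first exact: bmeas_sum.
  exact: bmeas_cst.
pose psi z := (1 - delta) * (\sum_i g i z * h i z) +
  ((1 - delta) * (\sum_i k i / a i * g i z) + C * delta).
have C0 : 0 <= C by exact: le_trans (c0 (point, point)) (cC _).
have psi0 z : 0 <= psi z.
  rewrite !addr_ge0 ?mulr_ge0//; last by case/andP: delta1.
  - by apply: sumr_ge0 => i _; rewrite mulr_ge0.
  - by apply: sumr_ge0 => i _; rewrite mulr_ge0// divr_ge0// ltW.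
have bpsi : bounded_measurable psi.
  apply: bmeasD; first by apply: bmeasZ; exact: bmeas_sum.
  apply: bmeasD; last exact: bmeas_cst.
  by apply: bmeasZ; apply: bmeas_sum => i; exact: bmeasZ.
have mcd : measurable_fun setT (fun zw => (c zw)%:E * (density zw)%:E)%E.
  by apply: emeasurable_funM; apply/measurable_EFinP => //; exact: mdensity.
have cd0 zw : (0 <= (c zw)%:E * (density zw)%:E)%E.
  by rewrite mule_ge0 ?lee_fin ?density_ge0.
have inner z : (\int[mu]_w ((c (z, w))%:E * (density (z, w))%:E) <= (psi z)%:E)%E.
  (* The majorant of cost times density is a sum of products of a function of z
     and a function of w, so its integral in w is explicit. *)
  pose m w := (1 - delta) * (\sum_i g i z / a i * (h i z * g i w + g i w * h i w)) +
    C * rest w.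
  have bterm i : bounded_measurable (fun w => h i z * g i w + g i w * h i w).
    by apply: bmeasD => //; exact: bmeasZ.
  have bsum : bounded_measurable
      (fun w => \sum_i g i z / a i * (h i z * g i w + g i w * h i w)).
    by apply: bmeas_sum => i; exact: bmeasZ.
  have bm : bounded_measurable m by apply: bmeasD; exact: bmeasZ.
  have mE : \int[mu]_w m w = psi z.
    rewrite RintegralD//; try exact: (bmeas_integrable _ (bmeasZ _ _)).
    rewrite RintegralZl; [|by []|exact: bmeas_integrable].
    rewrite RintegralZl; [|by []|exact: bmeas_integrable].
    rewrite Rintegral_rest Rintegral_comb// /psi addrA; congr (_ + _).
    rewrite -mulrDr -big_split/=; congr *%R; apply: eq_bigr => i _.
    rewrite RintegralD//; try by apply: bmeas_integrable => //; exact: bmeasZ.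
    rewrite RintegralZl; [|by []|exact: bmeas_integrable].
    rewrite -/(a i) -/(k i); field; by rewrite gt_eqF.
  rewrite -mE -EFin_Rintegral//; apply: ge0_le_integral => //.
  - exact: (measurableT_comp mcd (measurable_pair1 z)).
  - by apply/measurable_EFinP; case: bm.
  - move=> w _; rewrite -EFinM lee_fin mulrDr lerD//; last first.
      by rewrite ler_wpM2r// cC.
    rewrite mulrCA ler_wpM2l// mulr_sumr ler_sum// => i _ /=.
    rewrite mulrCA ler_wpM2l//; first by rewrite divr_ge0// ltW.
    by rewrite [g i w * _]mulrC -mulrDl ler_wpM2r.
rewrite integral_density_prob; [|exact/measurable_EFinP|by move=> zw; rewrite lee_fin].
rewrite fubini_tonelli1//.
apply: (@le_trans _ _ (\int[nu]_z (psi z)%:E)%E).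
  apply: ge0_le_integral => //.
  - by move=> z _; apply: integral_ge0.
  - exact: measurable_fun_fubini_tonelli_F.
  - by apply/measurable_EFinP; case: bpsi.
  - by move=> z _; exact: inner.
rewrite EFin_Rintegral// lee_fin.
rewrite RintegralD//; last 2 first.
- by apply: bmeas_integrable; apply: bmeasZ; exact: bmeas_sum.
- apply: bmeas_integrable; apply: bmeasD; last exact: bmeas_cst.
  by apply: bmeasZ; apply: bmeas_sum => i; exact: bmeasZ.
rewrite RintegralD//; last 2 first.
- by apply: bmeas_integrable; apply: bmeasZ; apply: bmeas_sum => i; exact: bmeasZ.
- by apply: bmeas_integrable; exact: bmeas_cst.
rewrite Rintegral_cst_prob RintegralZl//; last first.
  by apply: bmeas_integrable; exact: bmeas_sum.
rewrite RintegralZl//; last first.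
  by apply: bmeas_integrable; apply: bmeas_sum => i; exact: bmeasZ.
rewrite Rintegral_bigsum// Rintegral_comb// addrA [C * delta]mulrC lerD2r.
rewrite mulr_natl mulr2n; apply: lerD.
  rewrite (le_trans _ (sum_le nu))// ler_piMl//; last by case/andP: delta1; lra.
  by apply: sumr_ge0 => i _; apply: Rintegral_ge0 => x _; rewrite mulr_ge0.
rewrite (le_trans _ (sum_le mu))// mulr_sumr ler_sum// => i _.
rewrite -/(b i) -/(k i) (_ : _ * _ = (1 - delta) * b i / a i * k i); last first.
  by field; rewrite gt_eqF.
by rewrite ler_piMl// ler_pdivrMr// mul1r.
Qed.

End cell_coupling.

(** * Trigonometric coordinates and the torus distance *)

Section chord.
Context {R : realType}.

Lemma cos_pi_quarter_ge : 1 / 2 <= cos (pi / 4 : R).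
Proof.
have c0 : 0 <= cos (pi / 4 : R).
  by apply: cos_ge0_pihalf; have := @pi_gt0 R; lra.
have := cos_mulr2n (pi / 4 : R); rewrite (_ : pi / 4 *+ 2 = pi / 2); last by field.
rewrite cos_pihalf => h; nra.
Qed.

(** On the first half of the interval the mean value theorem bounds the slope from
    below; on the second half sine is at least its value at pi/4. *)
Lemma le_sin_half (t : R) : 0 <= t <= pi / 2 -> t / 4 <= sin t.
Proof.
move=> /andP[t0 tpi]; have p0 := @pi_gt0 R.
have [tq|tq] := leP t (pi / 4).
  have [->|tn0] := eqVneq t 0; first by rewrite sin0 mul0r.
  have {}t0 : 0 < t by rewrite lt_neqAle eq_sym tn0.
  have [x xt] := MVT t0 (fun x _ => is_derive_sin x)
    (continuous_subspaceT (@continuous_sin R)).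
  rewrite sin0 !subr0 => ->; move: xt; rewrite in_itv/= => /andP[x0 xt].
  have : cos (pi / 4) <= cos x.
    rewrite leNgt ltr_cos ?in_itv/=; last 2 first.
    - by apply/andP; split; lra.
    - by apply/andP; split; lra.
    by rewrite -leNgt; lra.
  by have := cos_pi_quarter_ge; nra.
have : sin (pi / 4) <= sin t.
  rewrite leNgt ltr_sin ?in_itv/=; last 2 first.
  - by apply/andP; split; lra.
  - by apply/andP; split; lra.
  by rewrite -leNgt; lra.
have -> : sin (pi / 4 : R) = cos (pi / 4).
  by rewrite -cosN -sinDpihalf; congr sin; field.
by have := cos_pi_quarter_ge; have := @pihalf_lt2 R; lra.
Qed.

(** The squared chord between the angles 2 pi a and 2 pi b is
    4 sin(pi (a - b))^2, to which the lower bound on sine applies. *)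
Lemma sqr_le_chord (a b : R) : `|a - b| <= 1 / 2 ->
  (a - b) ^+ 2 <= (cos (2 * pi * a) - cos (2 * pi * b)) ^+ 2 +
                  (sin (2 * pi * a) - sin (2 * pi * b)) ^+ 2.
Proof.
move=> ab; have p0 := @pi_gt0 R; have p2 := @pi_ge2 R.
have -> : (cos (2 * pi * a) - cos (2 * pi * b)) ^+ 2 +
    (sin (2 * pi * a) - sin (2 * pi * b)) ^+ 2 =
    2 - 2 * cos (2 * pi * a - 2 * pi * b).
  rewrite cosB; have := cos2Dsin2 (2 * pi * a); have := cos2Dsin2 (2 * pi * b).
  by move=> h1 h2; lra.
have -> : cos (2 * pi * a - 2 * pi * b) = cos (pi * `|a - b| *+ 2).
  have -> : pi * `|a - b| *+ 2 = `|2 * pi * a - 2 * pi * b|.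
    have tp0 : 0 <= 2 * pi :> R by rewrite mulr_ge0// ltW.
    by rewrite -mulrBr normrM (ger0_norm tp0) -[LHS]mulr_natl mulrA.
  by rewrite cos_norm.
have := @le_sin_half (pi * `|a - b|).
rewrite cos_mulr2n; have := cos2Dsin2 (pi * `|a - b|).
rewrite -[(a - b) ^+ 2]real_normK ?num_real//.
move: (normr_ge0 (a - b)) ab => d0 d2; set d := `|a - b| in d0 d2 *.
set S := sin _; set c := cos _ => h1 h2.
have h : d <= 2 * S.
  have pd : pi * d <= pi * (1 / 2) by rewrite ler_wpM2l// ltW.
  have : pi * d / 4 <= S by apply: h2; apply/andP; split; [rewrite mulr_ge0// ltW|lra].
  have : 2 * d <= pi * d by rewrite ler_wpM2r.
  by lra.
have : d * d <= (2 * S) * (2 * S) by rewrite ler_pM.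
by rewrite expr2; lra.
Qed.

Lemma exists_near_int (t : R) : exists2 z : R, z \is a Num.int & `|t - z| <= 1 / 2.
Proof.
exists (Num.floor (t + 1 / 2))%:~R; first exact: intr_int.
have /andP := floor_itv (t + 1 / 2); rewrite intrD => -[h1 h2].
by rewrite ler_norml; apply/andP; split; lra.
Qed.

End chord.

Section features.
Context {R : realType} {n : nat}.
Implicit Types x y : torus R n.

(** The cosines and sines of the coordinates determine a point of the torus. The
    affine change of scale sends them into [1/4, 3/4], so that the word weights
    with these success probabilities are bounded below by a positive constant. *)
Definition feature (l : 'I_n * bool) (x : torus R n) : R :=
  (2 + wave (delta_mx 0 l.1) (if l.2 then - (pi / 2) else 0) x) / 4.

Lemma trig_feature l : trig_poly (feature l).
Proof.
apply: trig_ext (trigZ (4^-1) (trigD (trig_cst 2) (trig_wave _ _))) => x.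
by rewrite /feature mulrC.
Qed.

Lemma feature_bounds l x : 1 / 4 <= feature l x <= 3 / 4.
Proof.
rewrite /feature; set w := wave _ _ _.
have : `|w| <= 1 by exact: cos_max.
by rewrite ler_norml => /andP[h1 h2]; apply/andP; split; lra.
Qed.

Lemma feature_cos i x : feature (i, false) x = (2 + cos (2 * pi * repr x 0 i)) / 4.
Proof. by rewrite /feature /wave/= map_delta_mx dot_deltal addr0. Qed.

Lemma feature_sin i x : feature (i, true) x = (2 + sin (2 * pi * repr x 0 i)) / 4.
Proof. by rewrite /feature /wave/= map_delta_mx dot_deltal cosBpihalf. Qed.

Lemma dist_torus_le (a b : 'rV[R]_n) : dist_torus (tproj a) (tproj b) <= enorm (a - b).
Proof.
apply: ge_inf; last by exists (a, b).
by exists 0 => _ [ab _ <-]; exact: enorm_ge0.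
Qed.

Lemma dist_torus_ge0 x y : 0 <= dist_torus x y.
Proof.
apply: lb_le_inf; last by move=> _ [ab _ <-]; exact: enorm_ge0.
by exists (enorm (repr x - repr y)), (repr x, repr y); rewrite //= !tproj_repr.
Qed.

(** Representatives whose coordinates differ by at most 1/2 are compared, one
    coordinate at a time, through [sqr_le_chord]; the factor 16 undoes the
    scaling by 1/4 of the features. *)
Lemma dist_torus_features x y :
  dist_torus x y ^+ 2 <= 16 * \sum_l (feature l x - feature l y) ^+ 2.
Proof.
have /choice[z /all_and2[zi zd]] : forall i, exists z : R,
    z \is a Num.int /\ `|repr x 0 i - repr y 0 i - z| <= 1 / 2.
  by move=> i; have [z ? ?] := exists_near_int (repr x 0 i - repr y 0 i); exists z.
pose b := repr y + \row_i z i.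
have yb : tproj b = y.
  rewrite -[RHS]tproj_repr; apply/tproj_eqP => i.
  by rewrite mxE addrAC subrr add0r mxE.
have -> : \sum_l (feature l x - feature l y) ^+ 2 =
    \sum_i ((feature (i, true) x - feature (i, true) y) ^+ 2 +
            (feature (i, false) x - feature (i, false) y) ^+ 2).
  rewrite (eq_bigr (fun l : 'I_n * bool => (feature (l.1, l.2) x - feature (l.1, l.2) y) ^+ 2)); last by case.
  rewrite -(pair_bigA _ (fun i c => (feature (i, c) x - feature (i, c) y) ^+ 2))/=.
  by apply: eq_bigr => i _; rewrite big_bool.
have le1 : dist_torus x y <= enorm (repr x - b).
  by rewrite -[x in leLHS]tproj_repr -[y in leLHS]yb dist_torus_le.
apply: (@le_trans _ _ (enorm (repr x - b) ^+ 2)).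
  by rewrite ler_pXn2r// nnegrE ?dist_torus_ge0// enorm_ge0.
rewrite sqr_sqrtr ?dotvv_ge0// mulr_sumr ler_sum// => i _.
rewrite -expr2 !feature_cos !feature_sin.
have -> : (repr x - b) 0 i = repr x 0 i - (repr y 0 i + z i) by rewrite !mxE.
have : `|repr x 0 i - (repr y 0 i + z i)| <= 1 / 2 by rewrite opprD addrA.
move=> /sqr_le_chord; rewrite (mulrDr (2 * pi)) cosD2pi_int//.
have -> : sin (2 * pi * repr y 0 i + 2 * pi * z i) = sin (2 * pi * repr y 0 i).
  by rewrite -!cosBpihalf addrAC cosD2pi_int.
move=> /le_trans; apply; rewrite le_eqVlt; apply/orP; left; apply/eqP.
by field.
Qed.

End features.

(** * Small deviation implies Wasserstein proximity *)

(** The integral of a nonnegative function is a supremum over the simple functions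
    below it. This gives monotonicity for functions whose measurability is not
    known, such as [dist_phase]. *)
Lemma ge0_integral_mono d (T : measurableType d) (R : realType)
    (P : {measure set T -> \bar R}) (f g : T -> \bar R) :
  (forall x, 0 <= f x)%E -> (forall x, f x <= g x)%E ->
  (\int[P]_x f x <= \int[P]_x g x)%E.
Proof.
move=> f0 fg; have g0 x : (0 <= g x)%E by exact: le_trans (fg x).
rewrite ge0_integralTE// ge0_integralTE//; apply: le_ereal_sup.
by move=> _ [h hf <-]; exists h => // x; exact: le_trans (hf x) (fg x).
Qed.

Lemma coupling_integral (R : realType) (n : nat)
    (nu mu : probability (borel_phase R n) R)
    (Q : probability (borel_phase R n * borel_phase R n)%type R)
    (f : borel_phase R n -> \bar R) :
  coupling nu mu Q -> measurable_fun setT f -> (forall z, 0 <= f z)%E ->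
  (\int[Q]_zw f zw.1 = \int[nu]_z f z)%E /\
  (\int[Q]_zw f zw.2 = \int[mu]_z f z)%E.
Proof.
move=> QM mf f0; split.
  transitivity (\int[pushforward Q fst]_z f z)%E.
    by rewrite ge0_integral_pushforward// => z _; exact: f0.
  apply: eq_measure_integral => A mA _.
  apply: (etrans _ (QM A mA).1); congr (Q _).
  by apply/seteqP; split => -[z w]//= [].
transitivity (\int[pushforward Q snd]_z f z)%E.
  by rewrite ge0_integral_pushforward// => z _; exact: f0.
apply: eq_measure_integral => A mA _.
  apply: (etrans _ (QM A mA).2); congr (Q _).
by apply/seteqP; split => -[z w]//= [].
Qed.

Section key.
Context {R : realType} {n : nat} (V : 'rV[R]_n).
Implicit Types nu : probability (borel_phase R n) R.

(** The position part of the distance is made polynomial in the features by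
    d <= eta + d^2 / eta; the velocity part only involves each marginal. *)
Lemma dist_phase_le (z w : phase R n) (eta : R) : 0 < eta ->
  dist_phase z w <=
    (eta + 16 / eta * \sum_l (feature l z.1 - feature l w.1) ^+ 2) +
    (velocity_gap V z + velocity_gap V w).
Proof.
move=> eta0; set Q := \sum_l _.
have Q0 : 0 <= Q by apply: sumr_ge0 => l _; exact: sqr_ge0.
have d0 := dist_torus_ge0 z.1 w.1; have e0 := enorm_ge0 (z.2 - w.2).
apply: (@le_trans _ _ (dist_torus z.1 w.1 + enorm (z.2 - w.2))).
  rewrite -[leRHS]ger0_norm ?addr_ge0// -sqrtr_sqr ler_wsqrtr//.
  by rewrite sqrrD addrAC lerDl mulrn_wge0// mulr_ge0.
apply: lerD.
  have := dist_torus_features z.1 w.1; rewrite -/Q => dQ.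
  apply: (@le_trans _ _ (eta + dist_torus z.1 w.1 ^+ 2 / eta)).
    rewrite -(ler_pM2r eta0) mulrDl divfK ?gt_eqF//.
    have := sqr_ge0 (dist_torus z.1 w.1 - eta); nra.
  by rewrite lerD2l [leRHS]mulrAC ler_wpM2r// invr_ge0 ltW.
rewrite (le_trans (enorm_le_l1norm _))//.
rewrite (_ : z.2 - w.2 = (z.2 - V) + - (w.2 - V)); last by rewrite opprB addrA subrK.
by rewrite (le_trans (l1normD _ _))// l1normN.
Qed.

Lemma trig_bmeas (p : torus R n -> R) : trig_poly p ->
  bounded_measurable (fun z : borel_phase R n => p z.1).
Proof.
move=> tp; split; last by have [M pM] := bounded_trig tp; exists M.
apply: continuous_measurable_phase.
by apply: (@continuous_pos R n _ p); exact: continuous_trig.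
Qed.

Lemma trig_coin (p : torus R n -> R) b : trig_poly p ->
  trig_poly (fun x => coin_weight (p x) b).
Proof.
case: b => // tp; apply: (trig_ext _ (trigD (trig_cst 1) (trigZ (-1) tp))) => x.
by rewrite mulN1r.
Qed.

Hypothesis nonresonant :
  forall k : 'rV[int]_n, k != 0 -> dot (map_mx intr k) V != 0.
Variable mu0 : probability (borel_phase R n) R.
Hypotheses (closed_mu0 : closed_measure mu0) (dev_mu0 : deviation V mu0 = 0).

(** The word weights of the features are cells for [cell_coupling]. The word length
    M makes the cells small, then delta makes the blindly moved mass harmless,
    and finally a small deviation makes the masses of the cells, which are means
    of trigonometric polynomials, close enough to those of [mu0]. The cost is
    given as a measurable majorant of the distance. *)
Lemma close_coupling (eta : R) : 0 < eta -> exists2 eps : R, 0 < eps &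
  forall nu, closed_measure nu -> deviation V nu <= eps ->
  exists2 Q, coupling nu mu0 Q &
  exists c : borel_phase R n * borel_phase R n -> R,
    [/\ measurable_fun setT c, forall zw, dist_phase zw.1 zw.2 <= c zw &
        (\int[Q]_zw (c zw)%:E <= eta%:E)%E].
Proof.
move=> eta_gt0; pose e := eta / 4; have e0 : 0 < e by rewrite divr_gt0.
pose L : finType := ('I_n * bool)%type.
have [M M0 Mle] : exists2 M : nat, (0 < M)%N & 32 / e * (#|L|%:R / M%:R) <= e / 2.
  pose x : R := 64 * #|L|%:R / e ^+ 2.
  have x0 : 0 <= x by rewrite divr_ge0// sqr_ge0.
  have xM := archi_boundP x0; exists (Num.bound x).
    by rewrite -(ltr_nat R) (le_lt_trans x0).
  have {xM} := ltW xM; rewrite ler_pdivrMr ?exprn_gt0// => xM.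
  have M0 : 0 < (Num.bound x)%:R :> R by exact: le_lt_trans (archi_boundP x0).
  rewrite mulrA ler_pdivrMr// [leLHS]mulrAC ler_pdivrMr//.
  by move: xM; rewrite expr2; lra.
pose W : finType := {ffun L * 'I_M -> bool}.
pose g (s : W) (x : torus R n) : R :=
  word_weight (fun c : L * 'I_M => feature c.1 x) s.
have tg s : trig_poly (g s).
  by apply: trig_prod => c; apply: trig_coin; exact: trig_feature.
have coin4 (u : R) b : 1 / 4 <= u <= 3 / 4 -> 1 / 4 <= coin_weight u b.
  by move=> /andP[? ?]; rewrite /coin_weight; case: b; lra.
(* All cells have mass at least gam for every probability measure. *)
pose gam : R := (1 / 4) ^+ #|{: L * 'I_M}|.
have gam0 : 0 < gam by rewrite exprn_gt0.
have g_ge s x : gam <= g s x.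
  rewrite /gam -prodr_const; apply: ler_prod => c _; apply/andP; split => //.
  exact: coin4 (feature_bounds _ _).
have g1 x : \sum_s g s x = 1 by exact: sum_word_weight.
have /choice[c /choice[K cK]] := fun s => trig_poly_mean nonresonant (tg s).
pose Kt : R := \sum_s K s.
have K0 s : 0 <= K s by case: (cK s).
have Kt0 : 0 <= Kt by apply: sumr_ge0.
(* Qmax bounds the position cost, features varying by less than 1. *)
pose Qmax : R := e + 16 / e * #|L|%:R.
have Qmax0 : 0 < Qmax.
  by rewrite ltr_pwDl// mulr_ge0// divr_ge0// ltW.
pose delta : R := Num.min 1 (e / Qmax).
have delta0 : 0 < delta by rewrite lt_min ltr01 divr_gt0.
have delta1 : delta <= 1 by rewrite ge_min lexx.
have deltaQ : delta * Qmax <= e by rewrite -ler_pdivlMr// ge_min lexx orbT.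
pose eps := Num.min (e) (delta * gam / (Kt + 1)).
have Kt1 : 0 < Kt + 1 by rewrite ltr_wpDl.
exists eps; first by rewrite lt_min e0 divr_gt0// mulr_gt0.
move=> nu nuc devnu.
have bg s : bounded_measurable (fun z : borel_phase R n => g s z.1).
  exact: trig_bmeas.
have gmean (P : probability (borel_phase R n) R) s : gam <= \int[P]_z g s z.1.
  rewrite -[leLHS](Rintegral_cst_prob P); apply: le_Rintegral => //.
    by apply: bmeas_integrable; exact: bmeas_cst.
  exact: bmeas_integrable.
have d0 := deviation_ge0 V nu.
have ab s : (1 - delta) * \int[nu]_z g s z.1 <= \int[mu0]_z g s z.1.
  have h1 := (cK s).2 nu nuc; have h2 := (cK s).2 mu0 closed_mu0.
  have a_c : \int[mu0]_z g s z.1 = c s.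
    by apply/eqP; rewrite -subr_eq0 -normr_le0 (le_trans h2)// dev_mu0 mulr0.
  have gm := gmean mu0 s; move: h1 gm; rewrite a_c => h1 gm.
  have Kd : K s * deviation V nu <= delta * gam.
    apply: (@le_trans _ _ ((Kt + 1) * (delta * gam / (Kt + 1)))); last first.
      by rewrite mulrC divfK// gt_eqF.
    apply: ler_pM => //.
      by rewrite ler_wpDr// /Kt (bigD1 s)//= lerDl sumr_ge0.
    by rewrite (le_trans devnu)// ge_min lexx orbT.
  have : \int[nu]_z g s z.1 <= c s + K s * deviation V nu.
    by rewrite -lerBlDl (le_trans _ h1)// ler_norm.
  have : delta * gam <= delta * c s by rewrite ler_pM2l.
  have : 0 <= 1 - delta by rewrite subr_ge0.
  move=> h3 h4 h5; apply: (le_trans (ler_wpM2l h3 h5)).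
  have : (1 - delta) * (K s * deviation V nu) <= K s * deviation V nu.
    by rewrite ler_piMl// ?mulr_ge0// lerBlDr lerDl ltW.
  by lra.
have [Q [QM QC]] := @cell_coupling _ (borel_phase R n) R nu mu0 W
  (fun s z => g s z.1) delta bg
  (fun s z => le_trans (ltW gam0) (g_ge s z.1)) (fun z => g1 z.1)
  (fun s => lt_le_trans gam0 (gmean mu0 s))
  (introT andP (conj (ltW delta0) delta1)) ab.
exists Q; first exact: QM.
(* The cost at scale e uses three of the four parts of eta = 4 e, and the
   deviation the last one. *)
pose cost (zw : borel_phase R n * borel_phase R n) : R :=
  e + 16 / e * \sum_l (feature l zw.1.1 - feature l zw.2.1) ^+ 2.
have bfeat l : bounded_measurable (fun z : borel_phase R n => feature l z.1).
  exact/trig_bmeas/trig_feature.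
have mcost : measurable_fun setT cost.
  apply: measurable_funD => //; apply: measurable_funM => //.
  apply: measurable_sum => l; apply: measurable_funX; apply: measurable_funB.
    exact: (measurableT_comp (bfeat l).1 measurable_fst).
  exact: (measurableT_comp (bfeat l).1 measurable_snd).
have cost0 zw : 0 <= cost zw.
  rewrite addr_ge0 ?(ltW e0)// mulr_ge0//; first by rewrite divr_ge0// ltW.
  by apply: sumr_ge0 => l _; exact: sqr_ge0.
have costint : (\int[Q]_zw (cost zw)%:E <= (3 * e)%:E)%E.
  (* Both points of the cell s are compared with the letter frequencies of s,
     and (A - B)^2 <= 2 (E - A)^2 + 2 (E - B)^2. *)
  pose h (s : W) (z : borel_phase R n) : R :=
    e / 2 + 32 / e * \sum_l (letter_frequency s l - feature l z.1) ^+ 2.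
  apply: (le_trans (QC cost h Qmax e _ _ _ _ _ _)) => //.
  - move=> s; apply: bmeasD; first exact: bmeas_cst.
    apply: bmeasZ; apply: bmeas_sum => l.
    have bdiff : bounded_measurable (fun z : borel_phase R n =>
        letter_frequency s l + -1 * feature l z.1).
      by apply: bmeasD; [exact: bmeas_cst|exact: bmeasZ].
    have := bmeasM bdiff bdiff; congr bounded_measurable.
    by apply/funext => z; rewrite mulN1r -expr2.
  - move=> s z w; rewrite /cost /h/= [leRHS]addrACA -[X in _ <= _ + X]mulrDr -big_split/=.
    apply: lerD; first by lra.
    rewrite (_ : 32 / e = 16 / e * 2); last by rewrite mulrAC -natrM.
    rewrite -[leRHS]mulrA ler_wpM2l//; first by rewrite divr_ge0// ltW.
    rewrite mulr_sumr ler_sum// => l _.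
    have := sqr_ge0 ((letter_frequency s l - feature l z.1) +
                     (letter_frequency s l - feature l w.1)).
    set E := letter_frequency s l; set A := feature _ _; set B := feature _ _.
    by nra.
  - move=> zw; rewrite /cost /Qmax lerD2l ler_wpM2l//.
      by rewrite divr_ge0// ltW.
    rewrite -sum1_card natr_sum ler_sum// => l _.
    have /andP[? ?] := feature_bounds l zw.1.1.
    by have /andP[? ?] := feature_bounds l zw.2.1; nra.
  - move=> z; rewrite /h.
    rewrite (eq_bigr (fun s => e / 2 * g s z.1 + 32 / e * (\sum_l g s z.1 *
        (letter_frequency s l - feature l z.1) ^+ 2))); last first.
      by move=> s _; rewrite -mulr_sumr mulrDr [_ * (e / 2)]mulrC [in RHS]mulrCA.
    rewrite big_split/= -!mulr_sumr g1 mulr1 exchange_big/=.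
    under eq_bigr => l _ do rewrite (word_variance (fun l => feature l z.1) l M0).
    apply: (@le_trans _ _ (e / 2 + e / 2)); last by lra.
    rewrite lerD2l (le_trans _ Mle)// ler_wpM2l//; first by rewrite divr_ge0// ltW.
    rewrite -sum1_card natr_sum mulr_suml ler_sum// => l _.
    rewrite ler_wpM2r ?invr_ge0//.
    by have /andP[? ?] := feature_bounds l z.1; nra.
  - by rewrite lee_fin; lra.
have mgap1 : measurable_fun setT (fun zw : borel_phase R n * borel_phase R n =>
    (velocity_gap V zw.1)%:E).
  apply/measurable_EFinP.
  exact: (measurableT_comp (measurable_velocity_gap V) measurable_fst).
have mgap2 : measurable_fun setT (fun zw : borel_phase R n * borel_phase R n =>
    (velocity_gap V zw.2)%:E).
  apply/measurable_EFinP.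
  exact: (measurableT_comp (measurable_velocity_gap V) measurable_snd).
have gapE (P : probability (borel_phase R n) R) : closed_measure P ->
    (\int[P]_z (velocity_gap V z)%:E = (deviation V P)%:E)%E.
  move=> Pc; rewrite fineK//; apply: integrable_fin_num => //.
  exact: integrable_velocity_gap.
have mgap : measurable_fun setT (fun z : borel_phase R n => (velocity_gap V z)%:E).
  by apply/measurable_EFinP; exact: measurable_velocity_gap.
have gap0 z : (0 <= (velocity_gap V z)%:E)%E by rewrite lee_fin l1norm_ge0.
have [gap1 gap2] := coupling_integral QM mgap gap0.
exists (fun zw => cost zw + (velocity_gap V zw.1 + velocity_gap V zw.2)); split.
- apply: measurable_funD => //; apply: measurable_funD.
    exact: (measurableT_comp (measurable_velocity_gap V) measurable_fst).
  exact: (measurableT_comp (measurable_velocity_gap V) measurable_snd).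
- by move=> zw; rewrite /cost; apply: dist_phase_le.
under eq_integral do rewrite (EFinD (cost _)) (EFinD (velocity_gap _ _)).
rewrite ge0_integralD//; last 4 first.
- by move=> zw _; rewrite lee_fin.
- by apply/measurable_EFinP.
- by move=> zw _; rewrite adde_ge0.
- by apply: emeasurable_funD.
rewrite ge0_integralD// gap1 gap2 !gapE// dev_mu0 adde0.
rewrite (_ : eta = 3 * e + e); last by rewrite /e; field.
rewrite EFinD; apply: leeD => //; rewrite lee_fin (le_trans devnu)//.
by rewrite ge_min lexx.
Qed.

Lemma W1_le_close (eta : R) : 0 < eta -> exists2 eps : R, 0 < eps &
  forall nu, closed_measure nu -> deviation V nu <= eps ->
  (W1 nu mu0 <= eta%:E)%E.
Proof.
move=> /close_coupling[eps eps0 H]; exists eps => // nu nuc dnu.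
have [Q QM [c [mc dc ic]]] := H nu nuc dnu.
apply: le_trans ic; apply: (@le_trans _ _ (\int[Q]_zw (dist_phase zw.1 zw.2)%:E)%E).
  by apply: ereal_inf_lbound; exists Q.
by apply: ge0_integral_mono => zw; rewrite lee_fin// sqrtr_ge0.
Qed.

End key.

(** * Uniqueness of the closed measure with constant velocity *)

Lemma nonexpansive_continuous (R : realType) (X : normedModType R) (g : X -> R) :
  (forall a b, g a <= g b + `|a - b|) -> continuous g.
Proof.
move=> Hg a; apply/cvgrPdist_le => r r0.
apply/nbhs_ballP; exists r => // b; rewrite -ball_normE /= => /ltW ab.
have := Hg a b; have := Hg b a.
rewrite distrC => h1 h2; rewrite ler_norml /=; apply/andP; split; lra.
Qed.

Section torus_distance_to_closed.
Context {R : realType} {n : nat} (O : set (torus R n)).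

Definition depth_values (x : torus R n) : set R :=
  [set `|ab.1 - ab.2| | ab in [set ab : 'rV[R]_n * 'rV[R]_n |
     tproj ab.1 = x /\ ~ O (tproj ab.2)]].

(** The sup distance to the complement of [O], as seen from all representatives of
    [x]; for an open [O] other than the whole torus it is Lipschitz
    and positive exactly on [O]. *)
Definition depth (x : torus R n) : R := inf (depth_values x).

Lemma norm_le_enorm (w : 'rV[R]_n) : `|w| <= enorm w.
Proof.
rewrite /Num.norm/=; have [->|/mx_norm_neq0[[i j] ->]/=] := eqVneq (mx_norm w) 0.
  exact: enorm_ge0.
by rewrite ord1; exact: coord_le_enorm.
Qed.

Hypothesis On : ~` O !=set0.

Lemma depth_values_inf x : has_inf (depth_values x).
Proof.
have [y Oy] := On; split.
  exists `|repr x - repr y|, (repr x, repr y) => //=.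
  by rewrite !tproj_repr.
by exists 0 => _ [ab _ <-].
Qed.

Lemma depth_ge0 x : 0 <= depth x.
Proof.
by apply: lb_le_inf; [case: (depth_values_inf x)|move=> _ [ab _ <-]].
Qed.

Lemma tproj_translate (a c e : 'rV[R]_n) :
  tproj a = tproj e -> tproj (a + (c - e)) = tproj c.
Proof.
move=> /tproj_eqP ae; apply/tproj_eqP => i.
rewrite (_ : _ - _ = a 0 i - e 0 i)//; by rewrite !mxE; ring.
Qed.

Lemma depth_lipschitz (c e : 'rV[R]_n) :
  depth (tproj c) <= depth (tproj e) + `|c - e|.
Proof.
rewrite -lerBlDr; apply: lb_le_inf; first by case: (depth_values_inf (tproj e)).
move=> _ [[a b] /= [ae Ob] <-]; rewrite lerBlDr.
apply: (@le_trans _ _ `|a + (c - e) - b|).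
  apply: ge_inf; first by case: (depth_values_inf (tproj c)).
  by exists (a + (c - e), b) => //=; rewrite tproj_translate.
by rewrite addrAC ler_normD.
Qed.

Lemma depth_dist x y : depth x <= depth y + dist_torus x y.
Proof.
rewrite -lerBlDl; apply: lb_le_inf.
  by exists (enorm (repr x - repr y)), (repr x, repr y); rewrite //= !tproj_repr.
move=> _ [[a b] /= [<- <-] <-]; rewrite lerBlDl.
by rewrite (le_trans (depth_lipschitz a b))// lerD2l norm_le_enorm.
Qed.

Lemma depth_out x : ~ O x -> depth x = 0.
Proof.
move=> Ox; apply/eqP; rewrite eq_le depth_ge0 andbT.
apply: ge_inf; first by case: (depth_values_inf x).
by exists (repr x, repr x) => /=; rewrite ?subrr ?normr0// tproj_repr.
Qed.

Lemma depth_gt0 x : open O -> O x -> 0 < depth x.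
Proof.
move=> oO Ox.
have : nbhs (repr x) (@tproj R n @^-1` O).
  apply: open_nbhs_nbhs; split; last by rewrite /preimage/= tproj_repr.
  exact: oO.
move=> /nbhs_ballP[r /= r0 rO].
apply: (lt_le_trans r0); apply: lb_le_inf; first by case: (depth_values_inf x).
move=> _ [[a b] /= [ax Ob] <-]; rewrite leNgt; apply/negP => abr.
apply: Ob; rewrite -(@tproj_translate (repr x) b a); last first.
  by rewrite tproj_repr.
by apply: rO; rewrite -ball_normE /= opprD addNKr opprB.
Qed.

Lemma continuous_depth : continuous depth.
Proof.
apply/continuous_torusP; apply: nonexpansive_continuous => a b /=.
exact: depth_lipschitz.
Qed.

End torus_distance_to_closed.

Lemma enormB (R : realType) (n : nat) (u v : 'rV[R]_n) : enorm (u - v) = enorm (v - u).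
Proof. by rewrite /enorm -opprB dotNr dotNl opprK. Qed.

Lemma dist_torusC (R : realType) (n : nat) (x y : torus R n) :
  dist_torus x y = dist_torus y x.
Proof.
rewrite /dist_torus; congr inf; apply/seteqP; split => _ [[a b] /= [ax bx] <-];
  by exists (b, a) => //=; rewrite enormB.
Qed.

Lemma open_section (X Y : topologicalType) (A : set (X * Y)) (y0 : Y) :
  open A -> open [set x | A (x, y0)].
Proof.
move=> oA; rewrite openE => x Ox.
have [[B1 B2] [/= nB1 nB2] BA] : nbhs (x, y0) A by exact: open_nbhs_nbhs.
rewrite /interior; apply: filterS nB1 => y B1y; apply: BA; split => //=.
exact: nbhs_singleton nB2.
Qed.

Lemma ae_velocity (R : realType) (n : nat) (V : 'rV[R]_n)
    (P : probability (borel_phase R n) R) :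
  closed_measure P -> deviation V P = 0 ->
  ae_eq P setT (fun z : borel_phase R n => z.2) (cst V).
Proof.
move=> cP dP.
have gap0 : (\int[P]_z `|(velocity_gap V z)%:E| = 0)%E.
  under eq_integral do rewrite gee0_abs ?lee_fin ?l1norm_ge0//.
  rewrite -[LHS]fineK; last first.
    by apply: integrable_fin_num => //; exact: integrable_velocity_gap.
  by congr EFin; exact: dP.
have mg : measurable_fun setT (fun z : borel_phase R n => (velocity_gap V z)%:E).
  by apply/measurable_EFinP; exact: measurable_velocity_gap.
have [+ _] := ae_eq_integral_abs P measurableT mg.
move=> /(_ gap0); apply: filterS => -[x v] /= /(_ I) [gz] _.
apply/eqP; rewrite -subr_eq0; apply/eqP/rowP => i; rewrite !mxE.
apply/eqP; rewrite -normr_le0 -gz /velocity_gap /l1norm (bigD1 i)//= !mxE lerDl.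
by apply: sumr_ge0.
Qed.

Section uniqueness.
Context {R : realType} {n : nat} (V : 'rV[R]_n).
Hypothesis nonresonant :
  forall k : 'rV[int]_n, k != 0 -> dot (map_mx intr k) V != 0.
Variables mu nu : probability (borel_phase R n) R.
Hypotheses (mu_closed : closed_measure mu) (nu_closed : closed_measure nu).
Hypotheses (dev_mu : deviation V mu = 0) (dev_nu : deviation V nu = 0).

(** The two measures have couplings of arbitrarily small cost, and the difference
    of the integrals is at most [K] times that cost. *)
Lemma eq_integral_lipschitz (h : torus R n -> R) (K : R) :
  continuous h -> (forall x, 0 <= h x) -> 0 < K ->
  (forall x y, h x <= h y + K * dist_torus x y) ->
  (\int[nu]_z (h z.1)%:E = \int[mu]_z (h z.1)%:E)%E.
Proof.
move=> ch h0 K0 hK.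
have mh : measurable_fun setT (fun z : borel_phase R n => (h z.1)%:E).
  apply/measurable_EFinP; apply: continuous_measurable_phase.
  exact: (@continuous_pos R n _ h).
have h0E (z : borel_phase R n) : (0 <= (h z.1)%:E)%E by rewrite lee_fin.
have dle (x y : torus R n) (z w : phase R n) : x = z.1 -> y = w.1 ->
    dist_torus x y <= dist_phase z w.
  move=> -> ->; rewrite -[leLHS]ger0_norm ?dist_torus_ge0// -sqrtr_sqr ler_wsqrtr//.
  by rewrite lerDl sqr_ge0.
have dC (x y : torus R n) : h y <= h x + K * dist_torus x y.
  by rewrite dist_torusC.
suff close e : 0 < e ->
    (\int[nu]_z (h z.1)%:E <= \int[mu]_z (h z.1)%:E + e%:E)%E /\
    (\int[mu]_z (h z.1)%:E <= \int[nu]_z (h z.1)%:E + e%:E)%E.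
  by apply/eqP; rewrite eq_le; apply/andP; split; apply/lee_addgt0Pr => e /close[].
move=> e0; have eK : 0 < e / K by rewrite divr_gt0.
have [eps eps0 H] := close_coupling nonresonant mu_closed dev_mu eK.
have [|Q QM [c [mc dc ic]]] := H nu nu_closed; first by rewrite dev_nu ltW.
have [I1 I2] := coupling_integral QM mh h0E.
have c0 zw : 0 <= c zw by apply: le_trans (dc zw); exact: sqrtr_ge0.
have Kc : (\int[Q]_zw (K%:E * (c zw)%:E) <= e%:E)%E.
  rewrite ge0_integralZl; [|by []|exact/measurable_EFinP|by move=> zw _; rewrite lee_fin|by rewrite lee_fin ltW].
  rewrite (_ : e = K * (e / K)); last by rewrite mulrC divfK// gt_eqF.
  by rewrite EFinM lee_wpmul2l// lee_fin ltW.
have mKc : measurable_fun setT (fun zw => K%:E * (c zw)%:E)%E.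
  by apply: emeasurable_funM => //; exact/measurable_EFinP.
have Kc0 zw : (0 <= K%:E * (c zw)%:E)%E by rewrite mule_ge0 ?lee_fin// ltW.
have mh1 : measurable_fun setT (fun zw : borel_phase R n * borel_phase R n => (h zw.1.1)%:E).
  exact: (measurableT_comp mh measurable_fst).
have mh2 : measurable_fun setT (fun zw : borel_phase R n * borel_phase R n => (h zw.2.1)%:E).
  exact: (measurableT_comp mh measurable_snd).
have KdQ zw : K * dist_torus zw.1.1 zw.2.1 <= K * c zw.
  by rewrite ler_wpM2l ?(ltW K0)// (le_trans _ (dc zw))// dle.
split.
- rewrite -I1 -I2; apply: (@le_trans _ _
    (\int[Q]_zw ((h zw.2.1)%:E + K%:E * (c zw)%:E))%E); last first.
    by rewrite ge0_integralD// leeD2l.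
  apply: ge0_integral_mono => zw; first by rewrite lee_fin.
  by rewrite -EFinM -EFinD lee_fin (le_trans (hK _ zw.2.1))// lerD2l.
- rewrite -I1 -I2; apply: (@le_trans _ _
    (\int[Q]_zw ((h zw.1.1)%:E + K%:E * (c zw)%:E))%E); last first.
    by rewrite ge0_integralD// leeD2l.
  apply: ge0_integral_mono => zw; first by rewrite lee_fin.
  by rewrite -EFinM -EFinD lee_fin (le_trans (dC zw.1.1 _))// lerD2l.
Qed.

(** The indicator of [O] is the increasing limit of the Lipschitz functions
    min(1, k depth). *)
Lemma eq_measure_cylinder (O : set (torus R n)) : open O ->
  nu (O `*` setT) = mu (O `*` setT).
Proof.
move=> oO; have [On|On] := pselect (~` O !=set0); last first.
  have -> : O `*` [set: 'rV[R]_n] = setT.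
    apply/seteqP; split => // -[x v] _; split => //=.
    by apply: contrapT => Ox; apply: On; exists x.
  by rewrite !probability_setT.
have mO : measurable (O `*` setT : set (borel_phase R n)).
  apply: sub_gen_smallest; rewrite (_ : _ `*` _ = fst @^-1` O).
    by apply: open_comp => // z _; exact: cvg_fst.
  by apply/seteqP; split => -[x v] //= [].
pose h k x : R := Num.min 1 (k%:R * depth O x).
have h0 k x : 0 <= h k x by rewrite le_min ler01 mulr_ge0// depth_ge0.
have ch k : continuous (h k).
  move=> x; apply: (@continuous_min _ _ (cst 1) (fun x => k%:R * depth O x)).
    exact: cst_continuous.
  apply: (@continuousM _ _ (cst k%:R) (depth O)); first exact: cst_continuous.
  exact: continuous_depth.
have hK k x y : h k x <= h k y + k.+1%:R * dist_torus x y.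
  have d0 := dist_torus_ge0 x y; have dd := depth_dist On x y.
  have le1 : k%:R * depth O x <= k%:R * depth O y + k.+1%:R * dist_torus x y.
    apply: (@le_trans _ _ (k%:R * (depth O y + dist_torus x y))).
      by rewrite ler_wpM2l.
    by rewrite mulrDr lerD2l ler_wpM2r// ler_nat.
  have d1 : 0 <= k.+1%:R * dist_torus x y by rewrite mulr_ge0.
  by rewrite /h; case: (ltP 1 (k%:R * depth O x));
    case: (ltP 1 (k%:R * depth O y)); lra.
have lim_h x : limn (fun k => (h k x)%:E) = (\1_O x)%:E.
  apply: cvg_lim => //; apply: cvg_near_cst; near=> k.
  rewrite /h indicE; case: (pselect (O x)) => Ox; last first.
    rewrite (memNset Ox) depth_out// mulr0.
    by case: (ltP 1 (0 : R)) => //; rewrite ltNge ler01.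
  rewrite (mem_set Ox) /Num.min; case: ifPn => //; rewrite -leNgt => h1.
  have : 1 <= k%:R * depth O x.
    rewrite -ler_pdivrMr ?depth_gt0//; near: k; exact: nbhs_infty_ger.
  by move=> h2; congr EFin; apply/eqP; rewrite eq_le h1.
have mh k : measurable_fun setT (fun z : borel_phase R n => (h k z.1)%:E).
  apply/measurable_EFinP; apply: continuous_measurable_phase.
  exact: (@continuous_pos R n _ (h k)).
have muO (P : probability (borel_phase R n) R) :
    P (O `*` setT) = limn (fun k => \int[P]_z (h k z.1)%:E)%E.
  rewrite -monotone_convergence//.
  - rewrite -[X in P X]setIT -integral_indic//; apply: eq_integral => -[x v] _.
    by rewrite lim_h !indicE in_setX in_setT andbT.
  - by move=> k z _; rewrite lee_fin.
  - move=> z _ k l kl; rewrite lee_fin /h.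
    have : k%:R * depth O z.1 <= l%:R * depth O z.1.
      by rewrite ler_wpM2r ?depth_ge0// ler_nat.
    by case: (ltP 1 (k%:R * depth O z.1));
      case: (ltP 1 (l%:R * depth O z.1)); lra.
rewrite !muO; congr (limn _); apply/funext => k.
by apply: (@eq_integral_lipschitz (h k) k.+1%:R).
Unshelve. all: by end_near. Qed.

(** Both measures are carried by the velocity [V], so only the slice of [A] at [V]
    counts. *)
Lemma eq_measure_open (A : set (phase R n)) : open A -> nu A = mu A.
Proof.
move=> oA; pose O := [set x | A (x, V)].
have oO : open O by exact: open_section.
have mA : measurable (A : set (borel_phase R n)) by exact: sub_gen_smallest.
have mO : measurable (O `*` setT : set (borel_phase R n)).
  apply: sub_gen_smallest; rewrite (_ : _ `*` _ = fst @^-1` O).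
    by apply: open_comp => // z _; exact: cvg_fst.
  by apply/seteqP; split => -[x v] //= [].
suff PA (P : probability (borel_phase R n) R) : closed_measure P ->
    deviation V P = 0 -> P A = P (O `*` setT).
  by rewrite !PA// eq_measure_cylinder.
move=> cP dP; rewrite -[X in P X = _]setIT -[X in _ = P X]setIT.
rewrite -!integral_indic//; apply: ae_eq_integral => //.
- by apply/measurable_EFinP; exact: measurable_indic.
- by apply/measurable_EFinP; exact: measurable_indic.
have := ae_velocity cP dP; apply: filterS => -[x v] /= /(_ I) -> _.
by rewrite !indicE in_setX in_setT andbT.
Qed.

Lemma eq_measure_closed (A : set (borel_phase R n)) : measurable A -> nu A = mu A.
Proof.
move=> mA.
apply: (@measure_unique _ R (borel_phase R n)
  (@open (torus R n * 'rV[R]_n)%type) (fun=> setT) _ _ _ _ nu mu _ _ A mA) => //.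
- exact: openI.
- by move=> _; exact: openT.
- by apply/seteqP; split => // x _; exists 0%N.
- by move=> B oB; exact: eq_measure_open.
- by move=> _; rewrite ltey_eq fin_num_measure.
Qed.

End uniqueness.

(** * Haar measure of the torus *)

Lemma pushforward_probability d1 d2 (T1 : measurableType d1)
    (T2 : measurableType d2) (R : realType) (P : probability T1 R)
    (f : T1 -> T2) : measurable_fun setT f ->
  exists Q : probability T2 R,
    (forall h : T2 -> \bar R, measurable_fun setT h -> (forall y, 0 <= h y)%E ->
      (\int[Q]_y h y = \int[P]_x h (f x))%E) /\
    (forall h : T2 -> \bar R, measurable_fun setT h ->
      P.-integrable setT (h \o f) -> (\int[Q]_y h y = \int[P]_x h (f x))%E).
Proof.
move=> mf; pose F : {mfun T1 >-> T2} := mfun_Sub (mem_set mf).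
exists (distribution P F); split=> h mh hh.
  by rewrite ge0_integral_distribution.
by rewrite integral_pushforward.
Qed.

Definition borel_rV (R : realType) (n : nat) : measurableType _ :=
  g_sigma_algebraType (@open 'rV[R]_n).

(** The line has a countable base, so an open set is a countable union of products
    of an open set by an interval with rational ends. *)
Lemma open_prod_measurable (R : realType) (n : nat) (W : set ('rV[R]_n * R)) :
  open W -> measurable (W : set (borel_rV R n * measurableTypeR R)).
Proof.
move=> oW.
pose X (p q : rat) : set 'rV[R]_n :=
  \bigcup_(N in [set N | open N /\ N `*` `]ratr p, ratr q[ `<=` W]) N.
have -> : W = \bigcup_p \bigcup_q (X p q `*` (`]ratr p, ratr q[ : set R)).
  apply/seteqP; split => [[x t] Wxt|[x t] [p _ [q _ [[N [oN NW] Nx] pq]]]].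
    have [[B1 B2] [/= nB1 nB2] BW] : nbhs (x, t) W by exact: open_nbhs_nbhs.
    have [N [[oN Nx] NB]] : exists N, open_nbhs x N /\ N `<=` B1.
      by move: nB1; rewrite nbhsE => -[N ? ?]; exists N.
    move: nB2 => /nbhs_ballP[r /= r0 rB].
    have tr : t - r < t by rewrite ltrBlDr ltrDl.
    have [p] := rat_in_itvoo tr.
    rewrite in_itv/= => /andP[p1 p2].
    have rt : t < t + r by rewrite ltrDl.
    have [q] := rat_in_itvoo rt.
    rewrite in_itv/= => /andP[q1 q2].
    exists p => //; exists q => //; split => /=; last by rewrite in_itv/= p2.
    exists N => //; split => // -[y s] /= [Ny]; rewrite in_itv/= => /andP[s1 s2].
    apply: BW; split => /=; first exact: NB.
    apply: rB; rewrite /ball/= ltr_norml; apply/andP; split; lra.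
  exact: NW.
apply: bigcupT_measurable_rat => p; apply: bigcupT_measurable_rat => q.
apply: measurableX.
  apply: sub_gen_smallest; apply: bigcup_open => N [oN _]; exact: oN.
exact: measurable_itv.
Qed.

Lemma measurable_shift (R : realType) (n : nat) (v : 'rV[R]_n) :
  measurable_fun setT
    (fun xt : borel_rV R n * measurableTypeR R => (xt.1 + xt.2 *: v : borel_rV R n)).
Proof.
apply: (@measurability _ _ _ (borel_rV R n) setT _ (@open 'rV[R]_n)); first by [].
move=> _ [A oA <-]; rewrite setTI; apply: open_prod_measurable.
apply: open_comp => // -[x t] _ /=.
apply: (@continuousD _ _ _ (fst : 'rV[R]_n * R -> _) (fun xt => xt.2 *: v)).
  exact: cvg_fst.
by apply: (@continuousZl _ _ _ (snd : 'rV[R]_n * R -> R^o)); exact: cvg_snd.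
Qed.

Definition periodic_rV {R : realType} {n : nat} (g : 'rV[R]_n -> R) :=
  forall a b, tproj a = tproj b -> g a = g b.

Lemma is_derive_line (R : realType) (V : normedModType R) (g : V -> R) (x v : V)
    (t : R) : differentiable g (x + t *: v) ->
  is_derive t 1 (fun s : R => g (x + s *: v)) ('D_v g (x + t *: v)).
Proof.
move=> dg; have dgv : derivable g (x + t *: v) v by exact: diff_derivable.
have E : (fun h : R => h^-1 *: ((fun s : R => g (x + s *: v)) (h *: 1 + t) -
      g (x + t *: v))) = fun h => h^-1 *: (g (h *: v + (x + t *: v)) - g (x + t *: v)).
  apply/funext => h; congr (_ *: (g _ - _)).
  by rewrite [h *: 1]mulr1 scalerDl addrCA.
by split; [rewrite /derivable|rewrite /derive]; rewrite /= E.
Qed.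

Section periodic.
Context {R : realType} {n : nat}.
Implicit Types g : 'rV[R]_n -> R.

Lemma tproj_addr (a b v : 'rV[R]_n) : tproj a = tproj b -> tproj (a + v) = tproj (b + v).
Proof.
move=> /tproj_eqP ab; apply/tproj_eqP => i.
by rewrite (_ : _ - _ = a 0 i - b 0 i)// !mxE; ring.
Qed.

Lemma periodic_shift g (v : 'rV[R]_n) : periodic_rV g -> periodic_rV (fun x => g (x + v)).
Proof. by move=> pg a b ab; apply: pg; exact: tproj_addr. Qed.

Lemma periodic_derive g (v : 'rV[R]_n) : periodic_rV g -> periodic_rV ('D_v g).
Proof.
move=> pg a b ab; rewrite /derive; congr (lim _).
suff -> : (fun h : R => h^-1 *: ((g \o shift a) (h *: v) - g a)) =
    (fun h => h^-1 *: ((g \o shift b) (h *: v) - g b)) by [].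
apply/funext => h /=; congr (_ *: (_ - _)); last exact: pg.
by apply: pg; rewrite ![h *: v + _]addrC; exact: tproj_addr.
Qed.

Lemma derive_shift_rV g (v w x : 'rV[R]_n) :
  'D_w (fun y => g (y + v)) x = 'D_w g (x + v).
Proof.
rewrite /derive; congr (lim _).
suff -> : (fun h : R => h^-1 *: (((fun y => g (y + v)) \o shift x) (h *: w) - g (x + v))) =
    (fun h => h^-1 *: ((g \o shift (x + v)) (h *: w) - g (x + v))) by [].
by apply/funext => h /=; rewrite addrA.
Qed.

Lemma C1_shift g (v : 'rV[R]_n) : C1 g -> C1 (fun x => g (x + v)).
Proof.
have csh : continuous (fun x : 'rV[R]_n => x + v).
  by move=> x; apply: (@continuousD _ _ _ id (cst v)); [exact: id|exact: cst_continuous].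
move=> [dg cg]; split=> [x|w].
  apply: (@differentiable_comp _ _ _ _ (fun x : 'rV[R]_n => x + v) g) => //.
rewrite (_ : 'D_w _ = 'D_w g \o (fun x => x + v)).
  by move=> x; apply: continuous_comp; [exact: csh|exact: cg].
by apply/funext => x; rewrite derive_shift_rV.
Qed.

Lemma torus_max (g : torus R n -> R) : continuous g -> exists x, forall y, g y <= g x.
Proof.
move=> cg; pose A := [set v : 'rV[R]_n | forall i, `[0, 1]%classic (v ord0 i)].
have cA : compact A.
  by apply: (@rV_compact R n (fun=> `[0, 1]%classic)) => i; exact: segment_compact.
have cgp : {within A, continuous (g \o @tproj R n)}.
  by apply: continuous_subspaceT; apply/continuous_torusP.
have A0 : A !=set0 by exists 0 => i; rewrite /= mxE in_itv/= lexx ler01.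
have [c _ cmax] := EVT_max_rV A0 cA cgp.
exists (tproj c) => y.
pose y' : 'rV[R]_n := \row_i (repr y 0 i - (Num.floor (repr y 0 i))%:~R).
have -> : y = tproj y'.
  rewrite -[LHS]tproj_repr; apply/tproj_eqP => i.
  by rewrite mxE opprB addrC subrK intr_int.
apply: cmax; rewrite inE => i /=; rewrite mxE in_itv/=.
have /andP := floor_itv (repr y 0 i); rewrite intrD => -[h1 h2].
by apply/andP; split; lra.
Qed.

Lemma torus_bounded (g : torus R n -> R) : continuous g ->
  exists M, forall x, `|g x| <= M.
Proof.
move=> cg; have [|x hx] := @torus_max (fun x => `|g x|).
  move=> x; apply: (@continuous_comp _ _ _ g Num.norm); first exact: cg.
  exact: norm_continuous.
by exists `|g x|.
Qed.

Lemma periodic_repr g : periodic_rV g -> (g \o repr) \o @tproj R n = g.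
Proof. by move=> pg; apply/funext => x /=; apply: pg; rewrite tproj_repr. Qed.

Lemma continuous_periodic g : continuous g -> periodic_rV g ->
  continuous (g \o repr : torus R n -> R).
Proof. by move=> cg pg; apply/continuous_torusP; rewrite periodic_repr. Qed.

Lemma periodic_bounded g : continuous g -> periodic_rV g ->
  exists M, forall x, `|g x| <= M.
Proof.
move=> cg pg; have [M gM] := torus_bounded (continuous_periodic cg pg).
exists M => x; rewrite -[g x](congr1 (fun k => k x) (periodic_repr pg)); exact: gM.
Qed.

End periodic.

Section haar.
Context {R : realType} {n : nat}.
Local Notation e_ i := (delta_mx 0 i : 'rV[R]_n).

(** This says that the derivatives of periodic functions in the direction [i] have
    mean zero. The constant [M] makes the integrand nonnegative, so that
    Tonelli's theorem and the fundamental theorem of calculus can be applied to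
    iterated integrals directly. *)
Definition annihilates_derivative (m : probability (borel_rV R n) R) (i : 'I_n) :=
  forall g : 'rV[R]_n -> R, C1 g -> periodic_rV g -> forall M : R,
    (forall x, `|'D_(e_ i) g x| <= M) ->
    (\int[m]_x ('D_(e_ i) g x + M)%:E = M%:E)%E.

Lemma measurable_rV (g : 'rV[R]_n -> R) : continuous g ->
  measurable_fun setT (g : borel_rV R n -> R).
Proof.
by move=> cg; apply: measurable_fun_real_rays => a; exact: open_gt_continuous.
Qed.

(** The primitive takes the same values at both ends of a period. *)
Lemma integral_line_derivative (g : 'rV[R]_n -> R) (i : 'I_n) (x : 'rV[R]_n) (M : R) :
  C1 g -> periodic_rV g -> (forall x, `|'D_(e_ i) g x| <= M) ->
  (\int[uniform_prob (@ltr01 R)]_t ('D_(e_ i) g (x + t *: e_ i) + M)%:E = M%:E)%E.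
Proof.
move=> [dg cg] pg gM.
pose F (t : R) := g (x + t *: e_ i) + M * t.
have dF (t : R) : is_derive t 1 F ('D_(e_ i) g (x + t *: e_ i) + M).
  have h1 := is_derive_line (dg (x + t *: e_ i)).
  have h2 : is_derive t 1 (M \*: (id : R -> R)) (M *: (1 : R)) by exact: is_deriveZ.
  have := is_deriveD h1 h2.
  by rewrite [M *: 1]mulr1.
have cF : continuous F.
  move=> t; apply: differentiable_continuous; apply/derivable1_diffP.
  by case: (dF t).
have cf : continuous (fun t : R => 'D_(e_ i) g (x + t *: e_ i) + M).
  move=> t; apply: (@continuousD _ _ _ (fun t : R => 'D_(e_ i) g (x + t *: e_ i)) (cst M));
    last exact: cst_continuous.
  apply: (@continuous_comp _ _ _ (fun t : R => x + t *: e_ i) ('D_(e_ i) g));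
    last exact: cg.
  apply: (@continuousD _ _ _ (cst x) (fun t : R => t *: e_ i)).
    exact: cst_continuous.
  by apply: (@continuousZl _ _ _ (id : R -> R^o)); exact: id.
rewrite integral_uniform; last 2 first.
- by apply/measurable_EFinP; exact: continuous_measurable_fun.
- by move=> t; rewrite lee_fin; have := gM (x + t *: e_ i); rewrite ler_norml; lra.
rewrite subr0 invr1 mul1e (continuous_FTC2 (F := F)) ?ltr01//.
- have F1 : F 1 = g x + M.
    rewrite /F scale1r mulr1; congr (_ + _); apply: pg; apply/tproj_eqP => j.
    rewrite !mxE addrAC subrr add0r; exact: intr_nat.
  have F0 : F 0 = g x by rewrite /F scale0r addr0 mulr0 addr0.
  by rewrite F1 F0 -EFinB addrAC subrr add0r.
- exact: continuous_subspaceT.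
- split.
  + by move=> t _; case: (dF t).
  + by apply: cvg_at_right_filter; exact: cF.
  + by apply: cvg_at_left_filter; exact: cF.
- by move=> t _; rewrite derive1E; case: (dF t).
Qed.

(** Induction on the set of directions: convolving with the uniform law on the
    segment [0, 1] e_j kills the derivatives in the direction j, by integrating
    along the segment first, and preserves the property for the previous
    directions, since translates of periodic functions are periodic. *)
Lemma haar_box (s : seq 'I_n) : exists m : probability (borel_rV R n) R,
  forall i, i \in s -> annihilates_derivative m i.
Proof.
elim: s => [|j s [m Hm]]; first by exists (dirac (0 : borel_rV R n)) => i; rewrite in_nil.
pose U : probability (measurableTypeR R) R := uniform_prob (@ltr01 R).
have [Q [QI _]] := pushforward_probability (m \x U)%E (measurable_shift (e_ j)).
exists Q => i; rewrite in_cons => ij g [dg cg] pg M gM.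
have mf : measurable_fun setT (fun x : borel_rV R n => ('D_(e_ i) g x + M)%:E).
  apply/measurable_EFinP; apply: measurable_funD => //.
  by apply: measurable_rV; exact: cg.
have f0 x : (0 <= ('D_(e_ i) g x + M)%:E)%E.
  by rewrite lee_fin; have := gM x; rewrite ler_norml; lra.
have mfs := measurableT_comp mf (measurable_shift (e_ j)).
rewrite QI//; have [ijE|ij'] := eqVneq i j.
  rewrite -ijE in mfs *.
  rewrite fubini_tonelli1// /fubini_F/=.
  under eq_integral => x _ do rewrite (integral_line_derivative x (conj dg cg) pg gM).
  by rewrite integral_cst// [X in (_ * X)%E]probability_setT mule1.
rewrite fubini_tonelli2// /fubini_G/=.
have inner (t : R) : (\int[m]_x ('D_(e_ i) g (x + t *: e_ j) + M)%:E = M%:E)%E.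
  have si : i \in s by move: ij; rewrite (negbTE ij').
  have := Hm i si _ (C1_shift (t *: e_ j) (conj dg cg)) (periodic_shift (t *: e_ j) pg) M.
  under eq_integral do rewrite derive_shift_rV.
  by apply => x; rewrite derive_shift_rV.
under eq_integral do rewrite inner.
by rewrite integral_cst// [X in (_ * X)%E]probability_setT mule1.
Qed.

End haar.

(** * The closed measure carried by a constant velocity *)

Section haar_measure.
Context {R : realType} {n : nat} (V : 'rV[R]_n).
Local Notation e_ i := (delta_mx 0 i : 'rV[R]_n).

Lemma periodic_tproj (phi : torus R n -> R) : periodic_rV (phi \o @tproj R n).
Proof. by move=> a b /= ->. Qed.

Lemma dtorus_tproj (phi : torus R n -> R) a :
  dtorus phi (tproj a) = grad (phi \o @tproj R n) a.
Proof.
apply/rowP => i; rewrite /dtorus /grad !mxE.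
by apply: (periodic_derive _ (periodic_tproj phi)); rewrite tproj_repr.
Qed.

Lemma continuous_dtorus (phi : torus R n -> R) i : C1_torus phi ->
  continuous (fun x => dtorus phi x 0 i).
Proof.
move=> [dp cp]; apply/continuous_torusP.
rewrite (_ : _ \o _ = 'D_(e_ i) (phi \o @tproj R n)); first exact: cp.
by apply/funext => a /=; rewrite dtorus_tproj mxE.
Qed.

Lemma measurable_dot_dtorus (phi : torus R n -> R) : C1_torus phi ->
  measurable_fun setT (fun z : borel_phase R n => dot (dtorus phi z.1) z.2).
Proof.
move=> C1phi; apply: continuous_measurable_phase.
apply: continuous_bigsum => i z.
apply: (@continuousM _ _ (fun z : phase R n => dtorus phi z.1 0 i)
  (fun z : phase R n => z.2 0 i)).
  exact: (@continuous_pos R n _ (fun x => dtorus phi x 0 i) (continuous_dtorus C1phi)).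
exact: (@continuous_vel R n _ (fun v => v 0 i) (@continuous_coord R n i)).
Qed.

Lemma annihilates_derivativeE (m : probability (borel_rV R n) R) i g :
  annihilates_derivative m i -> C1 g -> periodic_rV g ->
  \int[m]_x 'D_(e_ i) g x = 0.
Proof.
move=> mi [dg cg] pg.
have [M gM] := periodic_bounded (cg (e_ i)) (periodic_derive (e_ i) pg).
have bg : bounded_measurable (fun x : borel_rV R n => 'D_(e_ i) g x).
  by split; [apply: measurable_rV; exact: cg|exists M].
have := mi g (conj dg cg) pg M gM.
rewrite EFin_Rintegral; last by apply: bmeasD => //; exact: bmeas_cst.
rewrite RintegralD//; [|exact: bmeas_integrable|exact/bmeas_integrable/bmeas_cst].
by rewrite Rintegral_cst_prob => -[] /eqP; rewrite -subr_eq0 addrK => /eqP.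
Qed.

(** The law of (x, V), where x has the Haar law: the derivative of a function along
    V is a combination of partial derivatives, which have mean zero. *)
Lemma exists_closed_measure : exists mu0 : probability (borel_phase R n) R,
  closed_measure mu0 /\ deviation V mu0 = 0.
Proof.
have [m Hm] := @haar_box R n (enum 'I_n).
pose emb (a : 'rV[R]_n) : phase R n := (tproj a, V).
have memb : measurable_fun setT (emb : borel_rV R n -> borel_phase R n).
  apply: measurable_fun_generated => A oA.
  have : open [set x | A (x, V)] by exact: open_section.
  by apply: open_comp => a _; exact: continuous_tproj.
have [Q [QI0 QI]] := pushforward_probability m memb.
exists Q; split; last first.
  rewrite /deviation /Rintegral QI0//.
  - have gap0 a : velocity_gap V (emb a) = 0.
      by rewrite /velocity_gap subrr /l1norm big1// => i _; rewrite mxE normr0.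
    by under eq_integral do rewrite gap0; rewrite integral0.
  - by apply/measurable_EFinP; exact: measurable_velocity_gap.
  - by move=> z; rewrite lee_fin l1norm_ge0.
split.
  rewrite QI0.
  - by rewrite /= integral_cst// [X in (_ * X)%E]probability_setT mule1 ltry.
  - apply/measurable_EFinP; apply: (@continuous_measurable_phase R n (fun z => enorm z.2)).
    by apply: continuous_vel; exact: continuous_enorm.
  - by move=> z; rewrite lee_fin enorm_ge0.
move=> phi C1phi; set g := phi \o @tproj R n.
have pg : periodic_rV g by exact: periodic_tproj.
have bg i : bounded_measurable (fun a : borel_rV R n => 'D_(e_ i) g a).
  have [M gM] := periodic_bounded (C1phi.2 (e_ i)) (periodic_derive (e_ i) pg).
  by split; [apply: measurable_rV; exact: C1phi.2|exists M].
have E a : dot (dtorus phi (tproj a)) V = \sum_i V 0 i * 'D_(e_ i) g a.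
  by rewrite dtorus_tproj; apply: eq_bigr => i _; rewrite mxE mulrC.
have bsum : bounded_measurable (fun a : borel_rV R n => \sum_i V 0 i * 'D_(e_ i) g a).
  by apply: bmeas_sum => i; exact: bmeasZ.
rewrite QI/=.
- under eq_integral do rewrite E.
  rewrite EFin_Rintegral// Rintegral_bigsum; last by move=> i; exact: bmeasZ.
  rewrite big1// => i _; rewrite RintegralZl//; last exact: bmeas_integrable.
  by rewrite annihilates_derivativeE ?mulr0//; apply: Hm; rewrite mem_enum.
- by apply/measurable_EFinP; exact: measurable_dot_dtorus.
- rewrite (_ : _ \o _ = EFin \o (fun a => \sum_i V 0 i * 'D_(e_ i) g a)).
    exact: bmeas_integrable.
  by apply/funext => a /=; rewrite E.
Qed.

End haar_measure.

(** * Integrable Tonelli Hamiltonians and their Lagrangians *)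

(** Only the minorant has to be integrable: the Lagrangian may have infinite
    integral. *)
Lemma le_integral_minorant d (T : measurableType d) (R : realType)
    (P : {measure set T -> \bar R}) (g f : T -> \bar R) :
  P.-integrable setT g -> measurable_fun setT f -> (forall x, g x <= f x)%E ->
  (\int[P]_x g x <= \int[P]_x f x)%E.
Proof.
move=> ig mf gf.
rewrite integralE [leRHS]integralE; apply: leeB.
- apply: ge0_integral_mono => x; first exact: funepos_ge0.
  by rewrite !funeposE; apply: le_max2.
- apply: ge0_integral_mono => x; first exact: funeneg_ge0.
  by rewrite !funenegE; apply: le_max2 => //; rewrite leeN2.
Qed.

Section hamiltonian.
Context {R : realType} {n : nat} (H : 'rV[R]_n -> R).
Hypothesis TH : Tonelli (fun (_ : torus R n) p => H p).
Let V := grad H 0.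

Let differentiable_slice (G : 'rV[R]_n * 'rV[R]_n -> R) p :
  (forall z, differentiable G z) -> differentiable (fun p => G (0, p)) p.
Proof.
move=> dG; apply: (@differentiable_comp _ _ _ _ (fun p : 'rV[R]_n => (0 : 'rV[R]_n, p)) G) => //.
Qed.

Lemma differentiable_hamiltonian p : differentiable H p.
Proof.
by case: TH => -[[dG _] _] _ _; exact: (differentiable_slice p dG).
Qed.

Lemma differentiable_derive_hamiltonian v p : differentiable ('D_v H) p.
Proof.
case: TH => -[_ cG] _ _.
exact: (differentiable_slice p (cG (0 : 'rV[R]_n, v)).1).
Qed.

(** Convexity along the segment from 0 to [p]: the mean value theorem is applied to
    [H] and then to its derivative in the direction [p]. *)
Lemma hamiltonian_tangent p : H 0 + dot p V <= H p.
Proof.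
have [->|p0] := eqVneq p 0; first by rewrite dot0l addr0.
have dline (G : 'rV[R]_n -> R) (t : R) : (forall q, differentiable G q) ->
    is_derive t 1 (fun s : R => G (s *: p)) ('D_p G (t *: p)).
  move=> dG; have := @is_derive_line _ _ G 0 p t (dG _).
  by under eq_fun do rewrite add0r; rewrite add0r.
have cline (G : 'rV[R]_n -> R) : (forall q, differentiable G q) ->
    forall a b, {within `[a, b], continuous (fun s : R => G (s *: p))}.
  move=> dG a b; apply: continuous_subspaceT => t.
  apply: differentiable_continuous; apply/derivable1_diffP.
  by case: (dline G t dG).
have [x] := MVT ltr01 (fun t _ => dline H t differentiable_hamiltonian)
  (cline H differentiable_hamiltonian 0 1).
rewrite in_itv/= => /andP[x0 x1]; rewrite scale1r scale0r subr0 mulr1 => E1.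
have dH1 := differentiable_derive_hamiltonian p.
have [y _] := MVT x0 (fun t _ => dline ('D_p H) t dH1) (cline ('D_p H) dH1 0 x).
rewrite scale0r subr0 => E2.
have pos : 0 < 'D_p ('D_p H) (y *: p) by case: TH => _ conv _; exact: (conv point (y *: p) p p0).
have D0 : 'D_p H 0 = dot p V.
  by rewrite dotC dot_grad//; exact: differentiable_hamiltonian.
have : 0 <= 'D_p ('D_p H) (y *: p) * x by rewrite mulr_ge0// ltW.
lra.
Qed.

Lemma hamiltonian_near0 (eta : R) : 0 < eta -> exists2 s : R, 0 < s &
  forall p, `|p| <= s -> H p <= H 0 + dot p V + eta * `|p|.
Proof.
move=> eta0.
have /eqaddoP/(_ _ eta0) := diff_locally (differentiable_hamiltonian 0).
move=> /nbhs_ballP[s /= s0 hs]; exists (s / 2); first by rewrite divr_gt0.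
move=> p ps; have := hs p; rewrite -ball_normE /= sub0r normrN => /(_ _)/wrap[].
  by rewrite (le_lt_trans ps)// ltr_pdivrMr// ltr_pMr// ltr1n.
rewrite !fctE /= addr0 -deriveE; last exact: differentiable_hamiltonian.
rewrite -dot_grad; last exact: differentiable_hamiltonian.
rewrite dotC -/V => /ler_normlP[_]; lra.
Qed.

(** Perturbations by a potential [r]; both [H] and its perturbations by multiples of
    [f] have this form. *)
Definition shifted (r : torus R n -> R) : hamiltonian R n := fun x p => H p + r x.

Section shifted.
Variable r : torus R n -> R.
Hypothesis cr : continuous r.

Lemma lagrangian_ge p x v :
  ((dot p v - (H p + r x))%:E <= lagrangian (shifted r) x v)%E.
Proof. by apply: ereal_sup_ubound; exists p. Qed.

Lemma lagrangian_drift x : lagrangian (shifted r) x V = (- H 0 - r x)%:E.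
Proof.
apply/eqP; rewrite eq_le; apply/andP; split.
  apply: ge_ereal_sup => _ [p _ <-]; rewrite lee_fin /shifted.
  by have := hamiltonian_tangent p; lra.
by have := lagrangian_ge 0 x V; rewrite dot0l add0r opprD.
Qed.

(** A supremum of continuous functions is lower semicontinuous. *)
Lemma measurable_lagrangian :
  measurable_fun setT (fun z : borel_phase R n => lagrangian (shifted r) z.1 z.2).
Proof.
apply: measurable_fun_ereal_rays => a.
rewrite (_ : [set z | _] = \bigcup_p [set z : phase R n | a < dot p z.2 - (H p + r z.1)]).
  apply: bigcup_open => p _; apply: open_gt_continuous => z.
  apply: (@continuousB _ _ _ (fun z : phase R n => dot p z.2)
    (fun z : phase R n => H p + r z.1)).
    by apply: (@continuous_vel R n _ (dot p)); exact: continuous_dot.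
  apply: (@continuousD _ _ _ (cst (H p)) (fun z : phase R n => r z.1)).
    exact: cst_continuous.
  exact: (@continuous_pos R n _ r).
apply/seteqP; split => z /=.
  by move=> /ereal_sup_gt[_ [p _ <-]]; rewrite lte_fin => h; exists p.
by move=> [p _ h]; apply: lt_le_trans (lagrangian_ge p z.1 z.2); rewrite lte_fin.
Qed.

End shifted.
End hamiltonian.

(** * Mather measures of small perturbations *)

Section mather.
Context {R : realType} {n : nat} (H : 'rV[R]_n -> R).
Hypothesis TH : Tonelli (fun (_ : torus R n) p => H p).
Let V := grad H 0.
Variable mu0 : probability (borel_phase R n) R.
Hypotheses (closed_mu0 : closed_measure mu0) (dev_mu0 : deviation V mu0 = 0).
Implicit Types nu : probability (borel_phase R n) R.

Let bmeas_pos (r : torus R n -> R) : continuous r ->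
  bounded_measurable (fun z : borel_phase R n => r z.1).
Proof.
move=> cr; have [F rF] := torus_bounded cr; split; last by exists F.
by apply: continuous_measurable_phase; exact: (@continuous_pos R n _ r).
Qed.

Lemma action_mu0 (r : torus R n -> R) : continuous r ->
  (\int[mu0]_z lagrangian (shifted H r) z.1 z.2 =
   (- H 0 - \int[mu0]_z r z.1)%:E)%E.
Proof.
move=> cr; have br := bmeas_pos cr.
have bL : bounded_measurable (fun z : borel_phase R n => - H 0 + -1 * r z.1).
  by apply: bmeasD; [exact: bmeas_cst|exact: bmeasZ].
transitivity (\int[mu0]_z (- H 0 + -1 * r z.1)%:E)%E.
  apply: ae_eq_integral => //.
  - exact: measurable_lagrangian.
  - by apply/measurable_EFinP; case: bL.
  - have := ae_velocity closed_mu0 dev_mu0; apply: filterS => -[x v] /= /(_ I) -> _.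
    by rewrite lagrangian_drift// mulN1r.
rewrite EFin_Rintegral// RintegralD//; last 2 first.
- exact/bmeas_integrable/bmeas_cst.
- exact/bmeas_integrable/bmeasZ.
rewrite Rintegral_cst_prob RintegralZl//; last exact: bmeas_integrable.
by rewrite mulN1r.
Qed.

Lemma unperturbedE : (fun (_ : torus R n) p => H p) = shifted H (fun=> 0).
Proof. by apply/funext => x; apply/funext => p; rewrite /shifted addr0. Qed.

Lemma Mather_mu0 : Mather_measure (fun (_ : torus R n) p => H p) mu0.
Proof.
split=> // nu nuc; rewrite unperturbedE.
have c0 : continuous (fun _ : torus R n => 0 : R) by exact: cst_continuous.
rewrite action_mu0// Rintegral_cst_prob subr0.
rewrite -[leLHS](_ : \int[nu]_z (- H 0)%:E = _)%E; last first.
  by rewrite integral_cst// [X in (_ * X)%E]probability_setT mule1.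
apply: le_integral_minorant.
- exact: finite_measure_integrable_cst.
- exact: measurable_lagrangian.
- move=> z; have := lagrangian_ge H (fun=> 0) 0 z.1 z.2.
  by rewrite dot0l add0r addr0.
Qed.

(** The Legendre transform is evaluated at the momentum p = s sgn(v - V), for which
    <p, v - V> = s |v - V| and H(p) <= H(0) + <p, V> + eta s. *)
Lemma velocity_penalty (eta : R) : 0 < eta -> exists2 s : R, 0 < s &
  forall (r : torus R n -> R) x v,
  ((s * l1norm (v - V) - (eta * s + H 0 + r x))%:E <= lagrangian (shifted H r) x v)%E.
Proof.
move=> eta0; have [s s0 Hs] := hamiltonian_near0 TH eta0.
exists s => // r x v.
pose p : 'rV[R]_n := \row_i (s * Num.sg ((v - V) 0 i)).
have ps : `|p| <= s.
  rewrite /Num.norm/=; have [->|/mx_norm_neq0[[i j] ->]/=] := eqVneq (mx_norm p) 0.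
    exact: ltW.
  by rewrite mxE normrM (ger0_norm (ltW s0)) ler_piMr ?(ltW s0)// normr_sg lern1 leq_b1.
have dp : dot p (v - V) = s * l1norm (v - V).
  by rewrite mulr_sumr; apply: eq_bigr => i _; rewrite mxE -mulrA [`|_|]normrEsg.
apply: le_trans (lagrangian_ge H r p x v); rewrite lee_fin -dp dotBr.
have := Hs p ps; rewrite -/V.
have : eta * `|p| <= eta * s by rewrite ler_pM2l.
lra.
Qed.

(** The action of [nu], bounded below by [velocity_penalty], is at most the action
    of the competitor [mu0]; the two potential terms cost 2 F. *)
Lemma Mather_estimate (eta : R) : 0 < eta -> exists2 s : R, 0 < s &
  forall (r : torus R n -> R) (F : R) nu, continuous r ->
    (forall x, `|r x| <= F) -> Mather_measure (shifted H r) nu ->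
    s * deviation V nu <= eta * s + 2 * F.
Proof.
move=> eta0; have [s s0 Hs] := velocity_penalty eta0; exists s => // r F nu cr rF [nuc numin].
have br := bmeas_pos cr.
have igap := integrable_velocity_gap V nuc.
have isgap : nu.-integrable setT (EFin \o (fun z => s * velocity_gap V z)).
  exact: (integrableZl measurableT s igap).
have ir : nu.-integrable setT (EFin \o (fun z : borel_phase R n => eta * s + H 0 + r z.1)).
  by apply: bmeas_integrable; apply: bmeasD => //; exact: bmeas_cst.
have := numin mu0 closed_mu0; rewrite action_mu0//.
pose low (z : borel_phase R n) := s * velocity_gap V z - (eta * s + H 0 + r z.1).
have ilow : nu.-integrable setT (EFin \o low) by exact: (integrableB measurableT isgap ir).
have := @le_integral_minorant _ _ _ nu _ _ ilow (measurable_lagrangian H cr)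
  (fun z => Hs r z.1 z.2).
move=> /le_trans h /h{h}.
rewrite -[X in (X <= _)%E]fineK; last exact: integrable_fin_num.
rewrite lee_fin -/(Rintegral nu setT low) RintegralB// RintegralZl//.
rewrite RintegralD//; last 2 first.
- exact/bmeas_integrable/bmeas_cst.
- exact: bmeas_integrable.
rewrite Rintegral_cst_prob -/(deviation V nu).
have bound (P : probability (borel_phase R n) R) : `|\int[P]_z r z.1| <= F.
  apply: (le_trans (le_normr_Rintegral _ _)) => //; first exact: bmeas_integrable.
  rewrite -[leRHS](Rintegral_cst_prob P); apply: le_Rintegral => //.
    by apply: integrable_norm; exact: bmeas_integrable.
  exact/bmeas_integrable/bmeas_cst.
have := bound nu; have := bound mu0; rewrite !ler_norml => /andP[? ?] /andP[? ?].
lra.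
Qed.

(** With |f| <= F, the threshold on e makes 2 e F at most eta s / 2; F + 1 replaces F
    to have a positive denominator. *)
Lemma Mather_deviation (f : torus R n -> R) (eta : R) : continuous f -> 0 < eta ->
  exists2 e1 : R, 0 < e1 & forall e, 0 <= e < e1 -> forall nu,
    Mather_measure (fun x p => H p + e * f x) nu -> deviation V nu <= eta.
Proof.
move=> cf eta0; have [F fF] := torus_bounded cf.
have F0 : 0 <= F by exact: le_trans (fF point).
have eta2 : 0 < eta / 2 by rewrite divr_gt0.
have [s s0 Hs] := Mather_estimate eta2.
exists (s * eta / (4 * (F + 1))); first by rewrite divr_gt0 ?mulr_gt0// ltr_wpDl.
move=> e /andP[e0]; rewrite ltr_pdivlMr ?mulr_gt0// ?ltr_wpDl// => eF nu Mnu.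
have cef : continuous (fun x => e * f x).
  by move=> x; apply: (@continuousM _ _ (cst e) f); [exact: cst_continuous|exact: cf].
have := Hs (fun x => e * f x) (e * F) nu cef _ Mnu => /(_ _)/wrap[].
  by move=> x; rewrite normrM (ger0_norm e0) ler_wpM2l.
move=> h; rewrite -(ler_pM2l s0) (le_trans h)//.
move: eF; lra.
Qed.

End mather.

(** * Integer-valued functions and curves of constant velocity *)

Section integer_valued.
Context {R : realType}.

Lemma int_gap (a b : R) : a \is a Num.int -> b \is a Num.int -> a < b -> a + 1 <= b.
Proof.
move=> /intrP[m ->] /intrP[p ->]; rewrite ltr_int => mp.
by rewrite -[1 in leLHS]/(1%:~R) -intrD ler_int lezD1.
Qed.

Lemma int_half (a : R) : a \is a Num.int -> a + 1 / 2 \isn't a Num.int.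
Proof.
move=> ai; apply/negP => hi; have h : 1 / 2 \is a @Num.int R.
  by have := rpredB hi ai; rewrite addrAC subrr add0r.
have h0 : (0 : R) < 1 / 2 by lra.
by have := int_gap (rpred0 _) h h0; lra.
Qed.

(** Between two distinct integer values, the intermediate value theorem gives the
    smaller one plus 1/2. *)
Lemma continuous_int_segment (g : R -> R) (a b : R) : continuous g ->
  (forall t, g t \is a Num.int) -> a <= b -> g a = g b.
Proof.
move=> cg gi ab; apply: contrapT => /eqP gab.
pose v := Num.min (g a) (g b) + 1 / 2.
have vn : v \isn't a Num.int.
  by apply: int_half; rewrite /Num.min; case: ifP.
have [|c _ gc] := @IVT R g a b v ab (continuous_subspaceT cg).
  rewrite /v; case: (ltP (g a) (g b)) => [h|].
    by have := int_gap (gi a) (gi b) h; lra.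
  rewrite le_eqVlt eq_sym (negbTE gab)/= => h.
  by have := int_gap (gi b) (gi a) h; lra.
by move: vn; rewrite -gc gi.
Qed.

(** Two points are joined by a segment. *)
Lemma continuous_int_cst (n : nat) (g : 'rV[R]_n -> R) (x y : 'rV[R]_n) :
  continuous g -> (forall x, g x \is a Num.int) -> g x = g y.
Proof.
move=> cg gi; pose l (t : R) := x + t *: (y - x).
have cl : continuous l.
  move=> t; apply: (@continuousD _ _ _ (cst x) (fun t : R => t *: (y - x))).
    exact: cst_continuous.
  by apply: (@continuousZl _ _ _ (id : R -> R^o)); exact: id.
have := @continuous_int_segment (g \o l) 0 1 _ (fun t => gi _) ler01.
rewrite /= /l scale0r scale1r addr0 subrKC; apply => t.
by apply: continuous_comp; [exact: cl|exact: cg].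
Qed.

Lemma bounded_affine_slope (a b M : R) : (forall t : R, `|a + t * b| <= M) -> b = 0.
Proof.
move=> h; apply: contrapT => /eqP b0.
have := h ((M + 1 - a) / b); rewrite divfK// subrKC.
by move=> /(le_trans (ler_norm _)); lra.
Qed.

End integer_valued.

Section vector_curves.
Context {R : realType} {n : nat}.

Lemma is_derive_coord (Y : R -> 'rV[R]_n) (t : R) (d : 'rV[R]_n) i :
  is_derive t 1 Y d -> is_derive t 1 (fun s => Y s 0 i) (d 0 i).
Proof.
move=> [dY <-]; have := dY; move=> /derivable_mxP/(_ 0 i) dYi.
by split=> //; rewrite derive_mx// mxE.
Qed.

Lemma curve_cst_velocity (X : R -> 'rV[R]_n) (v : 'rV[R]_n) :
  (forall t : R, is_derive t 1 X v) -> forall t, X t = X 0 + t *: v.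
Proof.
move=> dX t; apply/rowP => i; rewrite !mxE.
have : X t 0 i - v 0 i * t = X 0 0 i - v 0 i * 0.
  apply: (@is_derive_0_is_cst R (fun s => X s 0 i - v 0 i * s)) => s.
  have h1 := is_derive_coord i (dX s).
  have h2 : is_derive s 1 (v 0 i \*: (id : R -> R)) (v 0 i *: (1 : R)) by exact: is_deriveZ.
  have := is_deriveB h1 h2.
  by rewrite [v 0 i *: 1]mulr1 subrr.
by rewrite mulr0; lra.
Qed.

Lemma grad_at_max (g : 'rV[R]_n -> R) (a : 'rV[R]_n) :
  differentiable g a -> (forall b, g b <= g a) -> (forall b, differentiable g b) ->
  grad g a = 0.
Proof.
move=> dg gmax dg'; apply/rowP => i; rewrite !mxE.
pose e := delta_mx 0 i : 'rV[R]_n.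
have dl (t : R) : is_derive t 1 (fun s : R => g (a + s *: e)) ('D_e g (a + t *: e)).
  exact: is_derive_line.
have I0 : (0 : R) \in `](-1), 1[ by rewrite in_itv/= ltrN10 ltr01.
have := @derive1_at_max R (fun s : R => g (a + s *: e)) (-1) 1 0 _ _ I0 _.
case.
- by rewrite (le_trans (lerN10 _)).
- by move=> t _; case: (dl t).
- by move=> t _; rewrite scale0r addr0.
by move=> _ h; have [_] := dl 0; rewrite h scale0r addr0 => <-.
Qed.

End vector_curves.

(** * Lifts of conjugacies and nonresonance *)

Lemma tproj_subint (R : realType) (n : nat) (k : 'rV[int]_n) (a b : 'rV[R]_n) :
  tproj a = tproj b -> dot (map_mx intr k) (a - b) \is a Num.int.
Proof. by move=> /tproj_eqP ab; apply: dot_int => i; rewrite !mxE; exact: ab. Qed.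

Lemma periodic_of_basis (R : realType) (n : nat) (g : 'rV[R]_n -> R) :
  (forall i y, g (y + delta_mx 0 i) = g y) -> periodic_rV g.
Proof.
move=> gi.
have gint (z : int) i y : g (y + z%:~R *: delta_mx 0 i) = g y.
  elim/int_rect: z y => [|m IH|m IH] y; first by rewrite scale0r addr0.
  - by rewrite intS [1 + _]addrC intrD scalerDl scale1r addrA gi IH.
  - rewrite -[RHS]IH -[LHS](gi i); congr g.
    by rewrite intS [1 + _]addrC opprD intrD scalerDl mulrN1z scaleN1r addrA subrK.
move=> a b /tproj_eqP ab.
have -> : a = b + \sum_i (a - b) 0 i *: delta_mx 0 i.
  by rewrite -row_sum_delta subrKC.
elim: (index_enum _) => [|i s IH]; first by rewrite big_nil addr0.
rewrite big_cons addrCA addrC -[RHS]IH.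
have /intrP[z hz] := ab i.
by rewrite (_ : (a - b) 0 i = z%:~R) ?gint// -hz !mxE.
Qed.

Lemma continuous_row (R : realType) (T : topologicalType) (n : nat)
    (Y : T -> 'rV[R]_n) : (forall i, continuous (fun x => Y x 0 i)) -> continuous Y.
Proof.
move=> cY x A [B nB BA].
suff : nbhs x [set y | forall i j, B i j (Y y i j)] by apply: filterS => y /BA.
apply: filter_forall => i; apply: filter_forall => j.
by rewrite ord1 in nB *; exact: (cY j x _ (nB 0 j)).
Qed.

Section nonresonance.
Context {R : realType} {n : nat}.

(** Reading the angle <k, .> through the lift of the inverse conjugacy gives a
    function F which changes by integers under integral translations. If
    <k, V> = 0, then F is constant on the line y0 + t omega. Subtracting the linear
    form <l, .> with the same periods leaves a bounded function, so
    <l, omega> = 0, l = 0 and F is bounded, whereas F o Psi - <k, .> is constant. *)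
Lemma lift_nonresonant (Psi Psi' : 'rV[R]_n -> 'rV[R]_n)
    (psi psi' : torus R n -> torus R n) (x0 y0 V omega : 'rV[R]_n) :
  (forall x, tproj (Psi x) = psi (tproj x)) ->
  (forall x, tproj (Psi' x) = psi' (tproj x)) ->
  (forall i, continuous (fun x => Psi x 0 i)) ->
  (forall i, continuous (fun x => Psi' x 0 i)) ->
  cancel psi psi' ->
  (forall t, psi (tproj (x0 + t *: V)) = tproj (y0 + t *: omega)) ->
  (forall k : 'rV[int]_n, k != 0 -> dot (map_mx intr k) omega != 0) ->
  forall k : 'rV[int]_n, k != 0 -> dot (map_mx intr k) V != 0.
Proof.
move=> PsiE Psi'E cPsi cPsi' psiK conj omega_nr k k0; apply/eqP => kV.
set kR := map_mx intr k in kV.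
pose F y := dot kR (Psi' y).
have cF : continuous F.
  apply: continuous_bigsum => i y.
  apply: (@continuousM _ _ (cst (kR 0 i)) (fun y => Psi' y 0 i)).
    exact: cst_continuous.
  exact: cPsi'.
have cshift (v : 'rV[R]_n) : continuous (fun y : 'rV[R]_n => y + v).
  by move=> y; apply: (@continuousD _ _ _ id (cst v)); [exact: id|exact: cst_continuous].
have cline (y v : 'rV[R]_n) : continuous (fun t : R => y + t *: v).
  move=> t; apply: (@continuousD _ _ _ (cst y) (fun t : R => t *: v)).
    exact: cst_continuous.
  by apply: (@continuousZl _ _ _ (id : R -> R^o)); exact: id.
(* Along the line, F differs from the constant <k, x0 + s V> by integers. *)
have Forbit t : F (y0 + t *: omega) = F y0.
  pose D s := F (y0 + s *: omega) - dot kR x0.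
  have cD : continuous D.
    move=> s; rewrite /D.
    apply: (@continuousB _ _ _ (fun s : R => F (y0 + s *: omega)) (cst (dot kR x0)));
      last exact: cst_continuous.
    apply: (@continuous_comp _ _ _ (fun t : R => y0 + t *: omega) F); first exact: cline.
    exact: cF.
  have Di s : D s \is a Num.int.
    have -> : D s = dot kR (Psi' (y0 + s *: omega) - (x0 + s *: V)).
      by rewrite /D /F !dotBr dotDr dotZr kV mulr0 addr0.
    by apply: tproj_subint; rewrite Psi'E -conj psiK.
  have : D t = D 0.
    by have [t0|/ltW t0] := leP 0 t; [symmetry|]; apply: continuous_int_segment.
  by rewrite /D scale0r addr0 => /addIr.
(* The increments of F over a period are integers, hence independent of y. *)
have Fper i y : F (y + delta_mx 0 i) - F y = F (delta_mx 0 i) - F 0.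
  rewrite -[in RHS](add0r (delta_mx 0 i)).
  apply: (@continuous_int_cst R n (fun y => F (y + delta_mx 0 i) - F y) y 0).
    move=> z; apply: (@continuousB _ _ _ (fun y : 'rV[R]_n => F (y + delta_mx 0 i)) F); last exact: cF.
    apply: (@continuous_comp _ _ _ (fun y : 'rV[R]_n => y + delta_mx 0 i) F).
      exact: cshift.
    exact: cF.
  move=> z; rewrite -dotBr; apply: tproj_subint; rewrite !Psi'E; congr psi'.
  apply/tproj_eqP => j; rewrite !mxE addrAC subrr add0r; exact: intr_nat.
have /choice[l hl] i : exists z : int, F (delta_mx 0 i) - F 0 = z%:~R.
  apply/intrP; rewrite -dotBr; apply: tproj_subint; rewrite !Psi'E; congr psi'.
  apply/tproj_eqP => j; rewrite !mxE subr0; exact: intr_nat.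
pose lv : 'rV[int]_n := \row_i l i.
set lR : 'rV[R]_n := map_mx intr lv.
pose G y := F y - dot lR y.
have cG : continuous G.
  by move=> y; apply: (@continuousB _ _ _ F (dot lR)); [exact: cF|exact: continuous_dot].
have pG : periodic_rV G.
  apply: periodic_of_basis => i y.
  have -> : G (y + delta_mx 0 i) = F (y + delta_mx 0 i) - F y - (l i)%:~R + G y.
    by rewrite /G dotDr dot_deltar !mxE; ring.
  by rewrite Fper hl subrr add0r.
have [M GM] := periodic_bounded cG pG.
have lomega : dot lR omega = 0.
  apply: oppr_inj; rewrite oppr0.
  apply: (@bounded_affine_slope R (F y0 - dot lR y0) _ M) => t.
  have := GM (y0 + t *: omega); rewrite /G Forbit dotDr dotZr.
  by rewrite opprD addrA mulrN.
have lv0 : lv = 0.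
  by apply: contrapT => /eqP /omega_nr; rewrite -/lR lomega eqxx.
have FM y : `|F y| <= M.
  have := GM y; rewrite /G /lR lv0 raddf0 dot0l subr0; exact.
have Fcst x : dot kR (Psi' (Psi x) - x) = dot kR (Psi' (Psi 0) - 0).
  apply: (@continuous_int_cst R n (fun x => dot kR (Psi' (Psi x) - x)) x 0).
    move=> z.
    apply: (@continuous_comp _ _ _ (fun x => Psi' (Psi x) - x) (dot kR));
      last exact: continuous_dot.
    apply: (@continuousB _ _ _ (fun x => Psi' (Psi x)) id); last exact: id.
    apply: (@continuous_comp _ _ _ Psi Psi'); exact: continuous_row.
  by move=> z; apply: tproj_subint; rewrite Psi'E PsiE psiK.
have : dot kR kR = 0.
  apply: (@bounded_affine_slope R (dot kR (Psi' (Psi 0))) _ M) => t.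
  have := FM (Psi (t *: kR)); congr (`|_| <= _).
  have := Fcst (t *: kR); rewrite subr0 !dotBr dotZr -/(F _).
  by move=> /eqP; rewrite subr_eq => /eqP.
move=> /eqP kk; move: k0 => /negP; apply; apply/eqP/rowP => i.
have : `|kR 0 i| <= 0.
  by rewrite (le_trans (coord_le_enorm _ _))// /enorm (eqP kk) sqrtr0.
by rewrite normr_le0 !mxE intr_eq0 => /eqP.
Qed.

End nonresonance.

(** * The drift of a KAM torus *)

Lemma diophantine_nonresonant (R : realType) (n : nat) (sigma tau : R)
    (omega : 'rV[R]_n) : 0 < sigma -> diophantine sigma tau omega ->
  forall k : 'rV[int]_n, k != 0 -> dot (map_mx intr k) omega != 0.
Proof.
move=> s0 dio k k0; have /= := dio k k0; set kR := map_mx intr k.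
have kR0 : 0 < enorm kR.
  rewrite lt_neqAle enorm_ge0 andbT eq_sym; apply: contra_neq k0 => kR0.
  apply/rowP => i; have := coord_le_enorm kR i.
  by rewrite kR0 normr_le0 !mxE intr_eq0 => /eqP.
move=> h; rewrite dotC -normr_gt0 (lt_le_trans _ h)// mulr_gt0// powR_gt0//.
Qed.

(** At a maximum [x0] of [u] the momentum vanishes, and it stays zero along the
    flow; so the orbit of (x0, 0) projects onto a line directed by the gradient of
    [H] at 0, which the conjugacy maps to a line directed by [omega]. *)
Lemma KAM_drift_nonresonant (R : realType) (n : nat) (H : 'rV[R]_n -> R)
    (u : torus R n -> R) (omega : 'rV[R]_n) :
  C1_torus u -> KAM_torus (fun _ p => H p) u omega ->
  (forall k : 'rV[int]_n, k != 0 -> dot (map_mx intr k) omega != 0) ->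
  forall k : 'rV[int]_n, k != 0 -> dot (map_mx intr k) (grad H 0) != 0.
Proof.
move=> [du _] [phi [flow _ [psi [[[Psi [PsiE cPsi]] [psi' [psiK _ [Psi' [Psi'E cPsi']]]]] conj]]]] omega_nr.
have cu : continuous u.
  by apply/continuous_torusP => a; exact: differentiable_continuous.
have [x0 xmax] := torus_max cu.
have du0 : dtorus u x0 = 0.
  apply: grad_at_max => // b; rewrite [leRHS]/= tproj_repr; exact: xmax.
have [phi0 [X HX]] := flow (x0, 0).
have p0 t : (phi t (x0, 0)).2 = 0.
  have dp (s : R) : is_derive s 1 (fun s => (phi s (x0, 0)).2) (0 : 'rV[R]_n).
    have [_ _] := HX s; congr (is_derive _ _ _ _).
    rewrite /dtorus /grad; apply/rowP => i; rewrite !mxE.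
    by rewrite (derive_cst (H (phi s (x0, 0)).2)) oppr0.
  by rewrite (curve_cst_velocity dp) phi0 scaler0 addr0.
have dX (t : R) : is_derive t 1 X (grad H 0).
  by have [_] := HX t; rewrite p0.
have XE := curve_cst_velocity dX.
apply: (@lift_nonresonant R n Psi Psi' psi psi' (X 0) (repr (psi x0)) _ omega) => //.
- by move=> i x; apply: differentiable_continuous; case: (cPsi i).
- by move=> i x; apply: differentiable_continuous; case: (cPsi' i).
- by move=> t; have := conj x0 t; rewrite du0 -XE; have [-> _ _] := HX t.
Qed.

(** * The modulus of continuity *)

(** The modulus at [r] is the infimum of the bounds valid on the whole of [0, r], to
    which 1 is added so that the set of bounds is not empty for large [r]. *)
Lemma exists_modulus (R : realType) (w : R -> set (\bar R)) :
  (forall eta : R, 0 < eta -> exists2 e1 : R, 0 < e1 &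
    forall e, 0 <= e < e1 -> forall x, w e x -> (x <= eta%:E)%E) ->
  exists Theta : R -> R, modulus_of_continuity Theta /\
    exists2 e1 : R, 0 < e1 & forall e, 0 <= e < e1 ->
      forall x, w e x -> (x <= (Theta e)%:E)%E.
Proof.
move=> small.
pose bounds (r : R) : set R := [set eta | 0 < eta /\ (eta = 1 \/
  forall e, 0 <= e <= r -> forall x, w e x -> (x <= eta%:E)%E)].
have inf_bounds r : has_inf (bounds r).
  by split; [exists 1; split; [exact: ltr01|left]|exists 0 => eta [/ltW]].
have Theta0 r : 0 <= inf (bounds r).
  by apply: lb_le_inf; [case: (inf_bounds r)|move=> eta [/ltW]].
have Theta_le r eta : bounds r eta -> inf (bounds r) <= eta.
  by apply: ge_inf; case: (inf_bounds r).
have Theta_small eta : 0 < eta -> exists2 e1, 0 < e1 &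
    forall r, r < e1 -> inf (bounds r) <= eta.
  move=> eta0; have [e1 e10 He1] := small eta eta0; exists e1 => // r re1.
  apply: Theta_le; split => //; right => e /andP[e0 er].
  have ee1 : 0 <= e < e1 by apply/andP; split => //; exact: le_lt_trans er re1.
  exact: (He1 e ee1).
exists (fun r => inf (bounds r)); split; last first.
  have [e1 e10 He1] := small 1 ltr01; exists e1 => // e ee x wx.
  have /andP[e0 _] := ee.
  have xle eta : bounds e eta -> (x <= eta%:E)%E.
    by move=> [_ [->|He]]; [exact: (He1 e ee)|apply: He wx; rewrite e0 /=].
  case: x wx xle => [x| |] wx xle.
  - rewrite lee_fin; apply: lb_le_inf; first by case: (inf_bounds e).
    by move=> eta /xle; rewrite lee_fin.
  - have := He1 e ee _ wx; by rewrite leye_eq.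
  - exact: leNye.
split.
- apply/eqP; rewrite eq_le Theta0 andbT; apply/ler_addgt0Pr => eta eta0.
  by have [e1 e10 h] := Theta_small eta eta0; rewrite add0r h.
- move=> r s r0 rs; apply: lb_le_inf; first by case: (inf_bounds s).
  move=> eta [eta0 [->|H]]; first by apply: Theta_le; split => //; left.
  apply: Theta_le; split => //; right => e /andP[e0 er].
  by apply: H; rewrite e0 (le_trans er).
- apply/cvgrPdist_le => eta eta0; have [e1 e10 He1] := Theta_small eta eta0.
  near=> r; rewrite sub0r normrN ger0_norm//; apply: He1.
  by near: r; exact: nbhs_right_lt.
Unshelve. all: by end_near. Qed.

Unset Implicit Arguments.

Theorem theorem4p5 (R : realType) (n : nat) (H : 'rV[R]_n -> R)
    (f : torus R n -> R) (u0 : torus R n -> R)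
    (sigma tau : R) (omega : 'rV[R]_n) :
  let H0 : hamiltonian R n := fun _ p => H p in
  let Heps (e : R) : hamiltonian R n := fun x p => H p + e * f x in
  (0 < n)%N ->
  Tonelli H0 ->
  C2_torus f ->
  (exists2 e0 : R, 0 < e0 & forall e, 0 <= e < e0 -> Tonelli (Heps e)) ->
  cvg_C2 (fun e => lift_ham (Heps e)) (lift_ham H0) ->
  0 < sigma ->
  n%:R - 1 <= tau ->
  diophantine sigma tau omega ->
  C11_torus u0 ->
  (forall x, H (dtorus u0 x) = ergodic_constant H0) ->
  KAM_torus H0 u0 omega ->
  exists mu0 : probability (borel_phase R n) R,
    [/\ Mather_measure H0 mu0,
        (forall nu : probability (borel_phase R n) R, Mather_measure H0 nu ->
           forall A, measurable A -> nu A = mu0 A)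
      & exists Theta : R -> R,
          modulus_of_continuity Theta /\
          exists2 e1 : R, 0 < e1 &
            forall e, 0 <= e < e1 ->
              forall mu : probability (borel_phase R n) R,
                Mather_measure (Heps e) mu ->
                (W1 mu mu0 <= (Theta e)%:E)%E].
Proof.
move=> H0 Heps _ TH [[df _] _] _ _ sigma0 _ dio [C1u _] _ kam.
have cf : continuous f.
  by apply/continuous_torusP => a; exact: differentiable_continuous.
have nonres := KAM_drift_nonresonant C1u kam (diophantine_nonresonant sigma0 dio).
have [mu0 [cmu0 dmu0]] := exists_closed_measure (grad H 0).
exists mu0; split; first exact: Mather_mu0.
- move=> nu Mnu A mA.
  apply: (eq_measure_closed nonres cmu0 Mnu.1 dmu0) mA.
  apply/eqP; rewrite eq_le deviation_ge0 andbT; apply/ler_addgt0Pr => eta eta0.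
  have c0 : continuous (fun _ : torus R n => 0 : R) by exact: cst_continuous.
  have [e1 e10 He1] := Mather_deviation TH cmu0 dmu0 c0 eta0.
  rewrite add0r; apply: (He1 0); first by rewrite lexx.
  by move: Mnu; rewrite /H0 unperturbedE; congr Mather_measure;
    apply/funext => x; apply/funext => p; rewrite mul0r.
have [|Theta [mTheta [e1 e10 He1]]] := @exists_modulus R
    (fun e => [set W1 mu mu0 | mu in Mather_measure (Heps e)]).
  move=> eta /(W1_le_close nonres cmu0 dmu0)[eps eps0 Heps'].
  have [e1 e10 He1] := Mather_deviation TH cmu0 dmu0 cf eps0.
  exists e1 => // e ee _ [mu Mmu <-].
  by apply: Heps'; [exact: Mmu.1|exact: (He1 e)].
exists Theta; split => //; exists e1 => // e ee mu Mmu.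
by apply: (He1 e ee); exists mu.
Qed.
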